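(* For any integer $m\ge 1$, the spider $S(4m+2,\,2m,\,1)$ is $e$-positive.
   Context: For a partition $\lambda=\lambda_1\cdots\lambda_d$ of $N-1$ with $d\ge 3$, the spider $S(\lambda)$ is the tree on $N$ vertices consisting of paths of lengths (numbers of edges) $\lambda_1,\dots,\lambda_d$ sharing exactly one common end vertex. Thus $S(4m+2,2m,1)$ has $6m+4$ vertices. The chromatic symmetric function of a finite simple graph $G$ with vertices $v_1,\dots,v_N$ is $X_G=\sum_{\kappa}x_{\kappa(v_1)}\cdots x_{\kappa(v_N)}$, a formal power series in commuting variables $x_1,x_2,\dots$, where $\kappa$ runs over all proper colorings of $G$ with positive integers as colors. For a partition $\lambda=\lambda_1\lambda_2\cdots$, $e_\lambda=e_{\lambda_1}e_{\lambda_2}\cdots$, where $e_r$ is the sum of all products of $r$ distinct variables $x_i$. The $e_\lambda$ form a basis of the algebra of symmetric functions. A symmetric function is $e$-positive if all its coefficients in the basis $\{e_\lambda\}$ are nonnegative. A graph $G$ is $e$-positive if $X_G$ is $e$-positive. *)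

(* Defs.v *)
From HB Require Import structures.
From mathcomp Require Import all_boot all_order all_algebra.
From mathcomp Require Import finmap multiset.
From mathcomp Require Import boolp classical_sets functions cardinality fsbigop.

Set Implicit Arguments.
Unset Strict Implicit.
Unset Printing Implicit Defensive.

Import GRing.Theory.

Local Open Scope classical_set_scope.
Local Open Scope mset_scope.
Local Open Scope ring_scope.

(** * Formal power series in countably many commuting variables *)

(* The variables are indexed by [nat] instead of the positive integers: index
   [i] stands for x_{i+1}.  A monomial is the multiset of the indices of its
   variables, so that [`+`] is the product of monomials and [mset0] is 1; a
   power series maps each monomial to its coefficient. *)
Definition monomial := {mset nat}.
Definition pseries := monomial -> int.

Definition ps_mon (a : monomial) : pseries := fun m => (m == a)%:R.

Definition ps_one : pseries := ps_mon mset0.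

(* [\sum_(i \in A)] is 0 by convention when infinitely many terms are nonzero;
   this never happens here, since a monomial has finitely many divisors. *)
Definition ps_mul (f g : pseries) : pseries := fun m =>
  \sum_(p \in [set p : monomial * monomial | p.1 `+` p.2 = m]) f p.1 * g p.2.

(* Sum of a family in which each monomial has a nonzero coefficient in only
   finitely many members.  This holds for both families used below: a monomial
   determines the squarefree set it comes from, and it comes from finitely many
   colorings of a finite graph. *)
Definition ps_sum (I : choiceType) (D : set I) (F : I -> pseries) : pseries :=
  fun m => \sum_(i \in D) F i m.

(** * Elementary symmetric functions and e-positivity *)

Definition elem_sym (r : nat) : pseries :=
  ps_sum [set A : {fset nat} | #|` A| = r] (fun A => ps_mon (seq_mset A)).

Definition is_partition (l : seq nat) : bool := sorted geq l && (0%N \notin l).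

Definition elem_sym_part (l : seq nat) : pseries :=
  foldr ps_mul ps_one [seq elem_sym r | r <- l].

(* [c] is the family of coordinates of [f] in the basis (e_l), l ranging over
   the partitions; as the e_l are linearly independent, [c] is determined by
   [f]. *)
Definition e_expansion (f : pseries) (c : {fsfun seq nat -> int with 0}) : Prop :=
  (forall l, l \in finsupp c -> is_partition l) /\
  (forall m, f m = \sum_(l <- finsupp c) c l * elem_sym_part l m).

Definition e_positive (f : pseries) : Prop :=
  exists c : {fsfun seq nat -> int with 0},
    e_expansion f c /\ forall l, 0 <= c l.

(** * Graphs and chromatic symmetric functions *)

Record sgraph := SGraph {
  vertex :> finType;
  adj : rel vertex;
  adj_sym : symmetric adj;
  adj_irr : irreflexive adj }.

Definition proper_coloring (G : sgraph) (k : {ffun G -> nat}) : Prop :=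
  forall u v : G, adj u v -> k u != k v.

Definition chromatic_sym (G : sgraph) : pseries :=
  ps_sum [set k : {ffun G -> nat} | proper_coloring k]
         (fun k => ps_mon (seq_mset [seq k v | v : G])).

Definition graph_e_positive (G : sgraph) : Prop := e_positive (chromatic_sym G).

(** * Spiders *)

(* [None] is the common end vertex of the legs; [Some (Tagged _ j)] with tag
   [i] is the vertex of leg [i] at distance [j + 1] from it. *)
Definition spider_vertex (l : seq nat) : finType :=
  option {i : 'I_(size l) & 'I_(nth 0%N l i)}.

Definition spider_adj (l : seq nat) : rel (spider_vertex l) := fun u v =>
  match u, v with
  | None, None => false
  | None, Some q => tagged q == 0%N :> nat
  | Some p, None => tagged p == 0%N :> nat
  | Some p, Some q =>
      (tag p == tag q) &&
      (((tagged p).+1 == tagged q :> nat) || ((tagged q).+1 == tagged p :> nat))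
  end.

Lemma spider_adj_sym (l : seq nat) : symmetric (@spider_adj l).
Proof. by case=> [p|] [q|] //=; rewrite eq_sym orbC. Qed.

Lemma spider_adj_irr (l : seq nat) : irreflexive (@spider_adj l).
Proof. by case=> [p|] //=; rewrite orbb gtn_eqF ?andbF. Qed.

Definition spider (l : seq nat) : sgraph :=
  SGraph (@spider_adj_sym l) (@spider_adj_irr l).

(* Main.v *)
Require Import Defs.
From mathcomp Require Import all_boot all_order all_algebra.
From mathcomp Require Import finmap multiset.
From mathcomp Require Import boolp classical_sets fsbigop.
From mathcomp Require Import mpoly ring zify.

Set Implicit Arguments.
Unset Strict Implicit.
Unset Printing Implicit Defensive.
Import GRing.Theory Num.Theory.

(** The spider with legs of lengths [b - 1], [a - 1] and 1, for [a = 2 m + 1] and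
    [b = 2 a + 1], has the chromatic symmetric function
    [P_(a+b) + e_1 P_(a+b-1) - P_a P_b], where [P_n] is that of the path with [n]
    vertices ([spider_colorings1]).  By the formula of Shareshian and Wachs
    ([path_polyE]), [P_n] is the sum of [i_1 (i_2 - 1) ... (i_l - 1)] times
    [e_(i_1) ... e_(i_l)] over the compositions of [n].  The terms with a factor
    [e_1] are easily compared ([spider_paths_pos]), so only compositions with all
    parts at least 2, called words, matter ([paths_pos]).

    Give a word the weight [(i_1 - 1) ... (i_l - 1)] times its [e]-monomial, and
    say that it hits [x] if some prefix has sum [x].  Let [t_1 = 1 / (i_1 - 1)] for
    the head [i_1].  In [P_(a+b) - P_a P_b], a word [K] of sum [a + b] contributes
    [1 + t_1(K)] times its weight, and a pair [(I, J)] of words of sums [a] and [b]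
    contributes [- (1 + t_1(I)) (1 + t_1(J))] times its weight.  Regard words as
    circular, by their sets of partial sums modulo [a + b = 3 a + 1].  Partial sums
    that differ by [a] come in runs of at most three, because no part is 1 and
    [3 a = -1] modulo [3 a + 1].  A run of two has a nonnegative total.  A run of
    three belongs to a cyclic sequence of words of sums [a], [a] and [a + 1]; its
    total is [1 - t_2 (1 + t_1 + t_3)] times the weight, where all [t_i] are at
    most 1 and [t_2] is that of a word of sum [a].  It can be negative only if the
    head in question is 2 or 3.  What remains are the words that hit neither [a]
    nor [b], with positive contributions, and they have to pay for this.

    For a head 2, the payment is a matter of the parity of [a].  Given words [I] of
    sum [a] and [2 :: J] of sum [a], both have odd parts, and letting the one
    that is closer to the cut jump over it yields a word of sum [2 a] that does not
    hit [a].  This map is injective and does not decrease the coefficients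
    ([jump], [jump_inj], [jump_bound]).  For a head 3, where the deficit is small,
    the words [X ++ 3 :: Y] with [X] of sum [2 a - 1] suffice; they hit none of
    [a], [2 a] and [b] ([rest_le]).

    Nonnegativity is established for polynomials in independent variables standing
    for the [e_k], so that one expansion serves for all monomials.  The
    coefficients of a monomial are then compared in a polynomial ring in as many
    variables [x_i] as the monomial requires ([e_positive_of_epos]). *)

(** * Words and their weights *)

(** Words are compositions with all parts at least 2: parts equal to 1 carry
    weight 0 in the path formula unless they come first, and are treated apart.
    The first argument is fuel. *)
Fixpoint words_below k n : seq (seq nat) :=
  if k is k'.+1 then
    if n == 0 then [:: [::]]
    else [seq p :: l | p <- iota 2 n.-1, l <- words_below k' (n - p)]
  else [::].

Definition words n := words_below n.+1 n.

Definition is_word := all (leq 2).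

Lemma mem_words_below k n l :
  n < k -> (l \in words_below k n) = (sumn l == n) && is_word l.
Proof.
elim: k n l => [//|k IHk] n l nk /=.
case: eqP => [->|/eqP n0].
  rewrite inE; case: l => [//|p l]; apply/esym/negbTE.
  rewrite /is_word /=; lia.
apply/allpairsPdep/andP => [[p [l' [p2 l'k ->]]]|].
  have pn : 1 < p <= n by move: p2; rewrite mem_iota; lia.
  move: l'k; rewrite IHk ?/is_word /=; last lia.
  by case/andP=> /eqP -> ->; split; lia.
case: l => [/=|p l]; rewrite /is_word /=; first lia.
case=> /eqP nE /andP [p2 al]; exists p, l; split=> //.
  rewrite mem_iota; lia.
rewrite IHk /is_word ?al; lia.
Qed.

Lemma mem_words n l : (l \in words n) = (sumn l == n) && is_word l.
Proof. exact: mem_words_below. Qed.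

Lemma uniq_words_below k n : uniq (words_below k n).
Proof.
elim: k n => [//|k IHk] n /=.
case: eqP => // _; apply: allpairs_uniq_dep => //; first exact: iota_uniq.
by move=> [p l] [p' l'] _ _ /= [-> ->].
Qed.

Lemma uniq_words n : uniq (words n).
Proof. exact: uniq_words_below. Qed.

Lemma words_nonnil n l : 0 < n -> l \in words n -> l != [::].
Proof. by rewrite mem_words; case: l => //=; lia. Qed.

Lemma word_cat l1 l2 : is_word (l1 ++ l2) = is_word l1 && is_word l2.
Proof. exact: all_cat. Qed.

Lemma cat_eq_cat (s1 t1 s2 t2 : seq nat) : s1 ++ t1 = s2 ++ t2 ->
  (exists w, s2 = s1 ++ w /\ t1 = w ++ t2) \/
  (exists w, s1 = s2 ++ w /\ t2 = w ++ t1).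
Proof.
elim: s1 s2 => [|k s1 IHs] [|k2 s2] /=.
- by move=> ->; left; exists [::].
- by move=> ->; left; exists (k2 :: s2).
- by move=> <-; right; exists (k :: s1).
by case=> <- /IHs [] [w [-> ->]]; [left|right]; exists w.
Qed.

(** Parts are positive, so a prefix is determined by its sum. *)
Lemma word_cat_inj l1 l2 l1' l2' : is_word l1 -> is_word l1' ->
  sumn l1 = sumn l1' -> l1 ++ l2 = l1' ++ l2' -> l1 = l1' /\ l2 = l2'.
Proof.
rewrite /is_word; elim: l1 l1' => [|k l1 IHl] [|k' l1'] //=; try lia.
move=> /andP [_ w] /andP [_ w'] e [ek el].
have [-> ->] // : l1 = l1' /\ l2 = l2' by apply: IHl => //; lia.
by rewrite ek.
Qed.

Fixpoint hits x l :=
  (x == 0) || (if l is k :: l' then (k <= x) && hits (x - k) l' else false).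

Lemma hitsP x l :
  reflect (exists l1 l2, l = l1 ++ l2 /\ sumn l1 = x) (hits x l).
Proof.
apply: (iffP idP).
  elim: l x => [|k l IHl] x /=.
    by rewrite orbF => /eqP ->; exists [::], [::].
  case/orP=> [/eqP ->|/andP [kx /IHl [l1 [l2 [-> e]]]]].
    by exists [::], (k :: l).
  by exists (k :: l1), l2; split=> //=; lia.
case=> l1 [l2 [-> <-]]; elim: l1 => [|k l1 IHl1] /=; first by case: l2.
by rewrite leq_addr addKn IHl1 orbT.
Qed.

Lemma hits_cat x l1 l2 : x <= sumn l1 -> hits x (l1 ++ l2) = hits x l1.
Proof.
elim: l1 x => [|k l1 IHl] x /=; first by rewrite leqn0 => /eqP ->; case: l2.
by move=> xk; case: (leqP k x) => //= kx; rewrite IHl //; lia.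
Qed.

Lemma hits_succ x l : is_word l -> hits x l -> ~~ hits x.+1 l.
Proof.
move=> wl /hitsP [l1 [l2 [E s1]]]; apply/negP => /hitsP [l3 [l4 [E' s3]]].
move: E' wl; rewrite E => /cat_eq_cat [] [w [E1 E2]]; subst.
  move: s3; rewrite sumn_cat !word_cat => s3 /and3P [_ + _].
  by case: w s3 => [|[|[|k]] w] /=; lia.
by move: s3; rewrite sumn_cat; lia.
Qed.

Lemma hits_pred x l : is_word l -> hits x.+1 l -> ~~ hits x l.
Proof. by move=> wl; apply: contraL => /(hits_succ wl). Qed.

Lemma hits2 l : is_word l -> hits 2 l = (head 0 l == 2).
Proof.
by case: l => //= k l /andP [k2 _]; case: k k2 => [|[|[|k]]] //=; case: l.
Qed.

Lemma hits3 l : is_word l -> hits 3 l = (head 0 l == 3).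
Proof.
case: l => //= k l /andP [k2 wl].
case: k k2 => [|[|[|[|k]]]] //= _; last by case: l wl.
by case: l wl => //= -[|[|]].
Qed.

Section Weights.
Local Open Scope ring_scope.
Variables (R : comNzRingType) (e : nat -> R).

Definition weight l := \prod_(k <- l) (k.-1%:R * e k).

(** The two relevant head factors are [w = id], which gives the coefficient of
    the composition in the chromatic symmetric function of a path, and
    [w = 1]; they add up like [k = k.-1 + 1]. *)
Definition head_weight (w : nat -> nat) l :=
  if l is k :: l' then (w k)%:R * e k * weight l' else 0.

Lemma weight_cat l1 l2 : weight (l1 ++ l2) = weight l1 * weight l2.
Proof. by rewrite /weight big_cat. Qed.

Lemma weight_cons k l : weight (k :: l) = k.-1%:R * e k * weight l.
Proof. by rewrite /weight big_cons. Qed.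

Lemma head_weight_cat w l1 l2 : l1 != [::] ->
  head_weight w (l1 ++ l2) = head_weight w l1 * weight l2.
Proof. by case: l1 => // k l _ /=; rewrite weight_cat mulrA. Qed.

Lemma weight_head l : l != [::] -> weight l = head_weight predn l.
Proof. by case: l => // k l _; rewrite weight_cons. Qed.

Definition wsum (Q : pred (seq nat)) n := \sum_(l <- words n | Q l) weight l.
Definition hsum w (Q : pred (seq nat)) n :=
  \sum_(l <- words n | Q l) head_weight w l.

Lemma big_hits (F : seq nat -> R) x n : (x <= n)%N ->
  \sum_(l <- words n | hits x l) F l =
  \sum_(l1 <- words x) \sum_(l2 <- words (n - x)) F (l1 ++ l2).
Proof.
move=> xn; transitivity (\sum_(l <- [seq l1 ++ l2 | l1 <- words x,
  l2 <- words (n - x)]) F l); last by rewrite big_allpairs_dep.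
rewrite -big_filter; apply: perm_big; apply: uniq_perm.
- by rewrite filter_uniq ?uniq_words.
- apply: allpairs_uniq; try exact: uniq_words.
  move=> [a b] [c d] /allpairsP [[a' b'] [/= wa _ [-> _]]].
  move=> /allpairsP [[c' d'] [/= wc _ [-> _]]].
  move: wa wc; rewrite !mem_words => /andP [/eqP sa wa] /andP [/eqP sc wc].
  by move=> E; have [-> ->] := word_cat_inj wa wc (etrans sa (esym sc)) E.
move=> l; rewrite mem_filter mem_words; apply/idP/idP.
  case/andP=> /hitsP [l1 [l2 [-> s1]]]; rewrite sumn_cat word_cat.
  case/andP=> /eqP s2 /andP [w1 w2]; apply/allpairsP; exists (l1, l2).
  by rewrite !mem_words w1 w2 s1 eqxx -s2 s1 addKn /= eqxx.
case/allpairsP=> [[l1 l2]] /= []; rewrite !mem_words.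
move=> /andP [/eqP s1 w1] /andP [/eqP s2 w2] ->.
rewrite sumn_cat word_cat s1 s2 subnKC // eqxx w1 w2 !andbT.
by apply/hitsP; exists l1, l2.
Qed.

Lemma wsum_ext (Q Q' : pred (seq nat)) n :
  (forall l, is_word l -> Q l = Q' l) -> wsum Q n = wsum Q' n.
Proof.
move=> E; rewrite /wsum big_seq_cond [RHS]big_seq_cond; apply: eq_bigl => l.
by rewrite mem_words; case wl: (is_word l); rewrite ?andbF //= E.
Qed.

Lemma hsum_ext w (Q Q' : pred (seq nat)) n :
  (forall l, is_word l -> Q l = Q' l) -> hsum w Q n = hsum w Q' n.
Proof.
move=> E; rewrite /hsum big_seq_cond [RHS]big_seq_cond; apply: eq_bigl => l.
by rewrite mem_words; case wl: (is_word l); rewrite ?andbF //= E.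
Qed.

Lemma wsum_split (Q Q' : pred (seq nat)) n :
  wsum Q n = wsum [pred l | Q' l & Q l] n + wsum [pred l | ~~ Q' l & Q l] n.
Proof.
rewrite /wsum (bigID Q') /=.
by congr (_ + _); apply: eq_bigl => l /=; rewrite andbC.
Qed.

Lemma hsum_split w (Q Q' : pred (seq nat)) n :
  hsum w Q n = hsum w [pred l | Q' l & Q l] n + hsum w [pred l | ~~ Q' l & Q l] n.
Proof.
rewrite /hsum (bigID Q') /=.
by congr (_ + _); apply: eq_bigl => l /=; rewrite andbC.
Qed.

Lemma wsum_cut (Q : pred (seq nat)) x y :
  (forall l1 l2, sumn l1 = x -> Q (l1 ++ l2) = Q l1) ->
  wsum [pred l | hits x l & Q l] (x + y) = wsum Q x * wsum predT y.
Proof.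
move=> QE; rewrite /wsum big_mkcondr big_hits ?leq_addr // addKn.
rewrite big_distrl /= [RHS]big_mkcond /=; apply: eq_big_seq => l1.
rewrite mem_words => /andP [/eqP s1 _]; under eq_bigr => l2 _ do rewrite QE //.
case: (Q l1); last by rewrite big1_eq.
by rewrite big_distrr; apply: eq_bigr => l2 _; rewrite weight_cat.
Qed.

Lemma hsum_cut w (Q : pred (seq nat)) x y : (0 < x)%N ->
  (forall l1 l2, sumn l1 = x -> Q (l1 ++ l2) = Q l1) ->
  hsum w [pred l | hits x l & Q l] (x + y) = hsum w Q x * wsum predT y.
Proof.
move=> x0 QE; rewrite /hsum big_mkcondr big_hits ?leq_addr // addKn.
rewrite big_distrl /= [RHS]big_mkcond /=; apply: eq_big_seq => l1 l1w.
have := l1w; rewrite mem_words => /andP [/eqP s1 _].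
under eq_bigr => l2 _ do rewrite QE //.
case: (Q l1); last by rewrite big1_eq.
rewrite big_distrr; apply: eq_bigr => l2 _.
by rewrite head_weight_cat // (words_nonnil x0).
Qed.

Lemma wsum_hits x y : wsum (hits x) (x + y) = wsum predT x * wsum predT y.
Proof. by rewrite -wsum_cut //; apply: wsum_ext => l _ /=; rewrite andbT. Qed.

Lemma hsum_hits w x y : (0 < x)%N ->
  hsum w (hits x) (x + y) = hsum w predT x * wsum predT y.
Proof.
by move=> x0; rewrite -hsum_cut //; apply: hsum_ext => l _ /=; rewrite andbT.
Qed.

Lemma wsum_head Q n : (0 < n)%N -> wsum Q n = hsum predn Q n.
Proof.
move=> n0; rewrite /wsum /hsum big_seq_cond [RHS]big_seq_cond.
by apply: eq_bigr => l /andP [lw _]; rewrite weight_head // (words_nonnil n0).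
Qed.

Lemma hsum_id Q n : (0 < n)%N -> hsum id Q n = wsum Q n + hsum (fun=> 1%N) Q n.
Proof.
move=> n0; rewrite wsum_head // /hsum -big_split /= big_seq_cond.
rewrite [RHS]big_seq_cond; apply: eq_bigr => -[|k l] /andP [lw _] /=.
  by rewrite addr0.
have k1 : (1 < k)%N by move: lw; rewrite mem_words => /andP [_ /andP []].
by rewrite -!mulrDl -natrD addn1 prednK // ltnW.
Qed.

Lemma hsum_rec w n : (0 < n)%N ->
  hsum w predT n = \sum_(2 <= p < n.+1) (w p)%:R * e p * wsum predT (n - p).
Proof.
case: n => // n _; have wE : words n.+1 =
    [seq p :: l | p <- iota 2 n, l <- words_below n.+1 (n.+1 - p)%N] by [].
rewrite /hsum wE big_allpairs_dep /index_iota !subSS subn0 big_seq.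
rewrite [RHS]big_seq; apply: eq_bigr => p.
rewrite mem_iota => p2; rewrite -big_distrr; congr (_ * _).
apply: perm_big; apply: uniq_perm; rewrite ?uniq_words_below ?uniq_words // => l.
by rewrite mem_words_below ?mem_words //; lia.
Qed.

Lemma wsum0 : wsum predT 0 = 1.
Proof. by rewrite /wsum /= big_cons big_nil /weight big_nil addr0. Qed.

Lemma wsum3 : wsum predT 3 = 2%:R * e 3.
Proof.
by rewrite /wsum /= !big_cons big_nil weight_cons /weight big_nil /=; ring.
Qed.

Lemma hsum2 w : hsum w predT 2 = (w 2)%:R * e 2.
Proof. by rewrite /hsum /= !big_cons big_nil /= /weight big_nil; ring. Qed.

Lemma hsum3 w : hsum w predT 3 = (w 3)%:R * e 3.
Proof. by rewrite /hsum /= !big_cons big_nil /= /weight big_nil; ring. Qed.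

(** By the formula of Shareshian and Wachs, the chromatic symmetric function of
    the path with [k.+1] vertices is the sum of [i_1 (i_2 - 1) ... (i_l - 1)]
    times [e_(i_1) ... e_(i_l)] over all compositions of [k.+1]; the second term
    below collects those that start with 1. *)
Definition path_e k := hsum id predT k.+1 + e 1 * wsum predT k.

End Weights.

Arguments wsum_split {R e}.
Arguments hsum_split {R e}.

(** * Jumps of odd parts over a cut *)

Definition evens := all (fun k => ~~ odd k).

Lemma odd_sumn_evens l : evens l -> ~~ odd (sumn l).
Proof.
by elim: l => [//|k l IHl] /= /andP [k0 /IHl]; rewrite oddD; case: odd k0.
Qed.

Lemma evens_cat l1 l2 : evens (l1 ++ l2) = evens l1 && evens l2.
Proof. exact: all_cat. Qed.

Lemma odd_sumn_find l : odd (sumn l) -> has odd l.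
Proof.
apply: contraLR => /hasPn no; apply: odd_sumn_evens; exact/allP.
Qed.

Lemma odd_in_prefix s x t B E : evens E -> odd x ->
  B ++ E = s ++ x :: t -> exists z, B = s ++ x :: z /\ t = z ++ E.
Proof.
move=> ev ox /cat_eq_cat [] [w [E1 E2]].
  by move: ev; rewrite E2 evens_cat /= ox andbF.
case: w E1 E2 => [|y w] E1 /= E2.
  by move: ev; rewrite -E2 /= ox.
by case: E2 E1 => <- -> ->; exists w.
Qed.

Lemma odd_in_suffix s x t E D : evens E -> odd x ->
  E ++ D = s ++ x :: t -> exists z, s = E ++ z /\ D = z ++ x :: t.
Proof.
move=> ev ox /cat_eq_cat [] [w [E1 E2]]; first by exists w.
case: w E1 E2 => [|y w] E1 /= E2.
  by exists [::]; rewrite E1 !cats0 -E2.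
by case: E2 E1 ev => <- _ ->; rewrite evens_cat /= ox andbF.
Qed.

(** For words [I] and [J] of odd sums, [I] of sum [a], the concatenation of [I],
    an additional part 2, and [J] hits [a].  A jump rearranges it into a word
    that does not.  Let [p] be the last odd part of [I] and [q] the first odd
    part of [J], so that only even parts lie between them.  If [I] ends with no
    more even parts than [J] starts with, then the part 2 moves to the front and
    [p] jumps to the right over the cut, past equally many even parts on both
    sides of it.  Otherwise [q] jumps to the left over the cut, again past
    equally many even parts on both sides, where the additional 2 is now one of
    them.  Jumps of this symmetric form can be undone without knowing how many
    parts were jumped over. *)
Variant jump (I J : seq nat) : seq nat -> Prop :=
| JumpRight B p A C Y of I = B ++ p :: A & J = C ++ Y & odd p & evens A
    & evens C & size A = size C :
    jump I J (2 :: B ++ A ++ C ++ p :: Y)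
| JumpLeft X A C q D of I = X ++ A & J = C ++ q :: D & odd q & evens A
    & evens C & size A = (size C).+1 :
    jump I J (X ++ q :: A ++ 2 :: C ++ D).

Definition jumped I J :=
  let c := find odd J in let r := rev I in let u := find odd r in
  if u <= c then
    2 :: rev (drop u.+1 r) ++ rev (take u r) ++ take u J ++ nth 0 r u :: drop u J
  else
    rev (drop c.+1 r) ++ nth 0 J c :: rev (take c.+1 r) ++ 2 :: take c J ++ drop c.+1 J.

Lemma evens_rev l : evens (rev l) = evens l.
Proof. exact: all_rev. Qed.

Lemma evens_take n l : n <= find odd l -> evens (take n l).
Proof.
elim: l n => [|k l IHl] [|n] //=; case: ifP => //= k0 nl.
exact: IHl.
Qed.

Lemma jumpedP I J : odd (sumn I) -> odd (sumn J) -> jump I J (jumped I J).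
Proof.
move=> oI /odd_sumn_find oJ.
have {oI} oI : has odd (rev I) by rewrite has_rev; exact: odd_sumn_find.
have sJ := oJ; have sI := oI; rewrite has_find in sJ; rewrite has_find in sI.
have nJ := nth_find 0 oJ; have nI := nth_find 0 oI; rewrite /jumped.
case: leqP => uc.
  apply: JumpRight => //.
  - by rewrite -[LHS]revK -[in LHS](cat_take_drop (find odd (rev I)) (rev I))
      (drop_nth 0) // rev_cat rev_cons cat_rcons.
  - by rewrite cat_take_drop.
  - by rewrite evens_rev evens_take.
  - exact: evens_take.
  - rewrite size_rev size_takel; last exact: ltnW.
    by rewrite size_takel // (leq_trans uc) // ltnW.
apply: JumpLeft => //.
- by rewrite -rev_cat cat_take_drop revK.
- by rewrite -drop_nth // cat_take_drop.
- by rewrite evens_rev evens_take.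
- exact: evens_take.
- rewrite size_rev size_takel; last exact: leq_trans uc (ltnW sI).
  by rewrite size_takel // ltnW.
Qed.

Lemma jump_sum I J K : jump I J K -> sumn K = (sumn I + sumn J).+2.
Proof. by case=> * ; subst; rewrite /= !sumn_cat /= ?sumn_cat /= ?sumn_cat /=; lia. Qed.

Lemma jump_word I J K : is_word I -> is_word J -> jump I J K -> is_word K.
Proof.
move=> wI wJ [] *; subst; move: wI wJ;
by rewrite /is_word /= !all_cat /= ?all_cat /= ?all_cat; do ![case/andP | move=> ->].
Qed.

Section Jump.
Variables (a : nat) (oa : odd a).

(** In a right jump, the sums between [a - p + 2] and the new place of [p] are
    even; in a left jump, those that follow the new place of [q] are even up to
    the old place of [q]. *)
Lemma jump_avoids I J K : is_word I -> sumn I = a ->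
  is_word J -> jump I J K -> ~~ hits a K.
Proof.
move=> wI sI wJ [].
- move=> B p A C Y EI EJ op eA eC szAC; apply/negP => /hitsP [l1 [l2 [E s1]]].
  have p3 : 2 < p.
    by move: wI; rewrite EI word_cat /= => /andP [_ /andP [p2 _]]; lia.
  move: sI; rewrite EI sumn_cat /= => sI.
  move: E; rewrite -!cat_cons catA => /cat_eq_cat [] [w [E1 E2]]; last first.
    by move: (congr1 sumn E1); rewrite /= ?sumn_cat /=; lia.
  have {E1} sw : sumn w = p - 2.
    by move: (congr1 sumn E1); rewrite !sumn_cat s1 /=; lia.
  case/cat_eq_cat: E2 => [] [v [E1 E2]].
    case: v E1 E2 => [|y v] E1 /= E2.
      move: (odd_sumn_evens eC); rewrite -[C]cats0 -E1 sw; lia.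
    case: E2 => ? _; subst y.
    by move: (congr1 sumn E1); rewrite !sumn_cat /=; lia.
  move: eC; rewrite E1 evens_cat => /andP [/odd_sumn_evens]; lia.
move=> X A C q D EI EJ oq eA eC szAC; apply/negP => /hitsP [l1 [l2 [E s1]]].
move: sI; rewrite EI sumn_cat => sI.
have A0 : 0 < sumn A.
  move: wI szAC; rewrite EI word_cat /is_word => /andP [_].
  by case: (A) => //= y ? /andP [+ _]; lia.
case/cat_eq_cat: E => [] [w [E1 E2]]; last first.
  by move: (congr1 sumn E1); rewrite !sumn_cat; lia.
have {E1} sw : sumn w = sumn A.
  by move: (congr1 sumn E1); rewrite !sumn_cat s1; lia.
case: w sw E2 => [|y w] /= sw; first lia.
case=> ? E2; subst y.
case/cat_eq_cat: E2 => [] [v [E1 E2]].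
  by move: (congr1 sumn E1); rewrite sumn_cat; lia.
move: (eA); rewrite E1 evens_cat => /andP [/odd_sumn_evens ew _].
move: (odd_sumn_evens eA); lia.
Qed.

Lemma jump_right_unique B p A C B' p' A' C' w :
  odd p -> evens (A' ++ C') ->
  sumn B + p + sumn A = a -> sumn B' + p' + sumn A' = a -> 0 < p' ->
  B' ++ A' ++ C' <> (B ++ A ++ C) ++ p :: w.
Proof.
move=> op ev s1 s2 p0 /(odd_in_prefix ev op) [z [E _]].
by move: (congr1 sumn E); rewrite !sumn_cat /=; lia.
Qed.

(** In a common image of a right and a left jump, [q] and [p] enclose a run of
    even parts.  The right jump passes the end of this run and has its middle
    at the sum [a - p + 2], so that this sum lies in the second half of the run.
    Likewise the middle [a + q] of the left jump lies in the first half.  But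
    [a - p + 2 < a + q]. *)
Lemma jump_right_left X A1 C1 q D B p A C Y :
  odd p -> odd q -> 2 < p -> evens A1 -> evens C1 -> evens A -> evens C ->
  size A = size C -> size A1 = (size C1).+1 ->
  sumn X + sumn A1 = a -> sumn B + p + sumn A = a ->
  X ++ q :: A1 ++ 2 :: C1 ++ D <> 2 :: B ++ A ++ C ++ p :: Y.
Proof.
move=> op oq p2 eA1 eC1 eA eC sz sz1 s1 s2.
have oX : odd (sumn X) by move: (odd_sumn_evens eA1); lia.
rewrite (_ : 2 :: B ++ A ++ C ++ p :: Y = (2 :: B ++ A ++ C) ++ p :: Y);
  last by rewrite /= -!catA.
move=> /cat_eq_cat [] [[|y w] [E1 E2]].
- move: (congr1 sumn E1); rewrite /= !sumn_cat /=.
  by move: (odd_sumn_evens eA) (odd_sumn_evens eC); lia.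
- case: E2 => ? E2; subst y.
  have ev : evens (A ++ C) by rewrite evens_cat eA.
  case/(odd_in_prefix ev oq): (E1 : (2 :: B) ++ A ++ C = _) => z [E3 E4].
  have ev1 : evens (A1 ++ 2 :: C1) by rewrite evens_cat eA1.
  move: E2; rewrite -cat_cons catA.
  case/(odd_in_suffix ev1 op) => z' [E5 _].
  have : (z ++ A) ++ C = A1 ++ (2 :: C1) ++ z' by rewrite -catA -E4 E5 -catA.
  case/cat_eq_cat => [] [v [E6 E7]].
  - case: v E6 E7 => [|y v] E6 E7.
      move: (congr1 sumn E6) (congr1 sumn E3).
      by rewrite cats0 !sumn_cat /= ?sumn_cat /=; lia.
    move: (congr1 size E6) (congr1 size E7); rewrite !size_cat /= ?size_cat /=.
    by clear - sz sz1; lia.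
  - by move: (congr1 sumn E6) (congr1 sumn E3); rewrite !sumn_cat /= ?sumn_cat /=; lia.
- move: (congr1 sumn E1); rewrite cats0 /= !sumn_cat /=.
  by move: (odd_sumn_evens eA) (odd_sumn_evens eC); lia.
- case: E2 => ? E2; subst y.
  by move: (congr1 sumn E1); rewrite /= !sumn_cat /= ?sumn_cat; lia.
Qed.

Lemma jump_left_unique X q A C X' A' w T' q' D :
  evens A -> evens C -> odd q' -> sumn X + sumn A = a -> sumn X' + sumn A' = a ->
  X' = X ++ q :: w -> A ++ 2 :: C ++ D = w ++ q' :: T' -> False.
Proof.
move=> eA eC oq' s1 s2 E1.
have ev : evens (A ++ 2 :: C) by rewrite evens_cat eA.
rewrite -cat_cons catA => /(odd_in_suffix ev oq') [z [E2 _]].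
move: (congr1 sumn E1); rewrite E2 !sumn_cat /= ?sumn_cat /=; lia.
Qed.

Lemma jump_right_same B p A C B' A' C' :
  is_word (B ++ p :: A) -> is_word (B' ++ p :: A') ->
  sumn B + sumn A = sumn B' + sumn A' -> size A = size C -> size A' = size C' ->
  B ++ A ++ C = B' ++ A' ++ C' -> [/\ B = B', A = A' & C = C'].
Proof.
move=> w w' s sz sz' E.
have [] := @word_cat_inj (B ++ A) C (B' ++ A') C'; rewrite -?catA //.
- by move: w; rewrite !word_cat /= => /andP [-> /andP [_ ->]].
- by move: w'; rewrite !word_cat /= => /andP [-> /andP [_ ->]].
- by rewrite !sumn_cat.
move=> E1 E2; have szA : size A = size A' by rewrite sz sz' E2.
have szB : size B = size B'.
  by move: (congr1 size E1); rewrite !size_cat szA => /addIn.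
by move/eqP: E1; rewrite eqseq_cat // => /andP [/eqP -> /eqP ->]; split.
Qed.

Lemma jump_left_same A C D A' C' D' : is_word A -> is_word A' ->
  sumn A = sumn A' -> size A = (size C).+1 -> size A' = (size C').+1 ->
  A ++ 2 :: C ++ D = A' ++ 2 :: C' ++ D' -> [/\ A = A', C = C' & D = D'].
Proof.
move=> w w' s sz sz' /(word_cat_inj w w' s) [E1 [/eqP E2]].
have szC : size C = size C' by apply: succn_inj; rewrite -sz -sz' E1.
by move: E2; rewrite eqseq_cat // => /andP [/eqP -> /eqP ->]; split.
Qed.

(** A right jump is undone by looking at the first odd part that ends beyond
    [a], a left jump by looking at the last odd part that starts before [a]. *)
Lemma jump_inj I J I' J' K : is_word I -> is_word I' ->
  sumn I = a -> sumn I' = a -> jump I J K -> jump I' J' K -> I = I' /\ J = J'.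
Proof.
move=> wI wI' sI sI' j j'; move: wI wI' sI sI'.
case: j j' => [B p A C Y -> -> op eA eC sz | X A C q D -> -> oq eA eC sz];
  move EK: (K in jump _ _ K) => K' j'; case: j' EK =>
  [B' p' A' C' Y' -> -> op' eA' eC' sz' | X' A' C' q' D' -> -> oq' eA' eC' sz'];
  move=> EK wI wI'; rewrite !sumn_cat /= => s s'.
- have p2 : 0 < p.
    by move: wI; rewrite word_cat /= => /and3P [_ /ltnW].
  have p2' : 0 < p'.
    by move: wI'; rewrite word_cat /= => /and3P [_ /ltnW].
  rewrite !addnA in s s'.
  have ev : evens (A ++ C) by rewrite evens_cat eA.
  have ev' : evens (A' ++ C') by rewrite evens_cat eA'.
  have same : B ++ A ++ C = B' ++ A' ++ C' -> p :: Y = p' :: Y' ->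
      B ++ p :: A = B' ++ p' :: A' /\ C ++ Y = C' ++ Y'.
    move=> E1 [Ep EY]; subst p' Y'.
    have sBA : sumn B + sumn A = sumn B' + sumn A'.
      by clear - s s'; lia.
    by have [-> -> ->] := jump_right_same wI wI' sBA sz sz' E1.
  case: EK => EK.
  have {EK} : (B ++ A ++ C) ++ p :: Y = (B' ++ A' ++ C') ++ p' :: Y'.
    by rewrite -!catA.
  case/cat_eq_cat => [] [[|y w] [E1 E2]].
  + by apply: same; rewrite // E1 cats0.
  + case: E2 => ? _; subst y.
    by case: (jump_right_unique op ev' s s' p2' E1).
  + by apply: same; rewrite // E1 cats0.
  + case: E2 => ? _; subst y.
    by case: (jump_right_unique op' ev s' s p2 E1).
- have p2 : 1 < p by move: wI; rewrite word_cat /= => /andP [_ /andP []].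
  rewrite addnA in s.
  by case: (@jump_right_left X' A' C' q' D' B p A C Y) => //; clear - op p2; lia.
- have p2 : 1 < p' by move: wI'; rewrite word_cat /= => /andP [_ /andP []].
  rewrite addnA in s'.
  by case: (@jump_right_left X A C q D B' p' A' C' Y') => //; clear - op' p2; lia.
- have same : X = X' -> q :: A ++ 2 :: C ++ D = q' :: A' ++ 2 :: C' ++ D' ->
      X ++ A = X' ++ A' /\ C ++ q :: D = C' ++ q' :: D'.
    move=> E1 [E2 E3]; subst X' q'.
    have wA : is_word A by move: wI; rewrite word_cat => /andP [].
    have wA' : is_word A' by move: wI'; rewrite word_cat => /andP [].
    have sA : sumn A = sumn A' by clear - s s'; lia.
    by have [-> -> ->] := jump_left_same wA wA' sA sz sz' E3.
  move: EK => /cat_eq_cat [] [[|y w] [E1 E2]].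
  + by apply: same; rewrite // E1 cats0.
  + case: E2 => ? E2; subst y.
    by case: (jump_left_unique eA eC oq' s s' E1 E2).
  + by apply: same; rewrite // E1 cats0.
  + case: E2 => ? E2; subst y.
    by case: (jump_left_unique eA' eC' oq s' s E1 E2).
Qed.

End Jump.

(** * e-positivity of a difference of paths *)

(** In this part, [pos] stands for any predicate that holds for [e k] and is
    stable under sums and products, such as nonnegativity of the coefficients
    when the [e k] are independent variables. *)
Section Cone.
Local Open Scope ring_scope.
Variables (R : comNzRingType) (e : nat -> R) (pos : R -> Prop).
Hypothesis pos0 : pos 0.
Hypothesis pos1 : pos 1.
Hypothesis posD : forall x y, pos x -> pos y -> pos (x + y).
Hypothesis posM : forall x y, pos x -> pos y -> pos (x * y).
Hypothesis pose : forall k, pos (e k).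

Local Notation weight := (weight e).
Local Notation head_weight := (head_weight e).
Local Notation f := (wsum e).
Local Notation h := (hsum e).
Local Notation F := (f predT).
Local Notation G := (h id predT).
Local Notation H1 := (h (fun=> 1%N)).
Local Notation H := (H1 predT).
Local Notation avoids x := (fun l => ~~ hits x l).
Local Notation path_e := (path_e e).

Lemma pos_nat n : pos n%:R.
Proof. by elim: n => [//|n IHn]; rewrite -addn1 natrD; apply: posD. Qed.

Lemma pos_sum (I : eqType) (s : seq I) (Q : pred I) (F : I -> R) :
  (forall i, i \in s -> Q i -> pos (F i)) -> pos (\sum_(i <- s | Q i) F i).
Proof.
move=> posF; rewrite big_seq_cond; elim/big_ind: _ => // i /andP [si Qi].
exact: posF.
Qed.

Lemma pos_weight l : pos (weight l).
Proof.
by apply: big_ind => // k _; apply: posM => //; exact: pos_nat.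
Qed.

Lemma pos_head_weight w l : pos (head_weight w l).
Proof.
case: l => //= k l; do ?apply: posM => //; [exact: pos_nat | exact: pos_weight].
Qed.

Lemma pos_wsum Q n : pos (f Q n).
Proof. by apply: pos_sum => l _ _; exact: pos_weight. Qed.

Lemma pos_hsum w Q n : pos (h w Q n).
Proof. by apply: pos_sum => l _ _; exact: pos_head_weight. Qed.

Lemma hsum_le_wsum Q n : (0 < n)%N -> pos (f Q n - h (fun=> 1%N) Q n).
Proof.
move=> n0; rewrite wsum_head // /hsum -sumrB; apply: pos_sum => -[|k l] lw _ /=.
  by rewrite subrr.
have k1 : (1 < k)%N by move: lw; rewrite mem_words => /andP [_ /andP []].
rewrite -!mulrBl -natrB; last by lia.
do ?apply: posM => //; [exact: pos_nat | exact: pos_weight].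
Qed.

Lemma sum_inj_le (S T : eqType) (X : seq S) (Y : seq T) (phi : S -> T)
    (wX : S -> R) (wY : T -> R) :
  uniq X -> uniq Y -> {in X &, injective phi} -> {in X, forall x, phi x \in Y} ->
  {in Y, forall y, pos (wY y)} -> {in X, forall x, pos (wY (phi x) - wX x)} ->
  pos (\sum_(y <- Y) wY y - \sum_(x <- X) wX x).
Proof.
move=> uX uY inj sub posY leX.
rewrite (bigID (mem (map phi X))) /= -big_filter.
rewrite (perm_big (map phi X)); last first.
  apply: uniq_perm; rewrite ?filter_uniq ?map_inj_in_uniq // => y.
  by rewrite mem_filter; case: mapP => // -[x xX ->]; rewrite sub.
rewrite big_map addrAC -sumrB; apply: posD.
  by apply: pos_sum => x xX _; exact: leX.
by apply: pos_sum => y yY _; exact: posY.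
Qed.

Lemma wsum_le (Q Q' : pred (seq nat)) n : (forall l, is_word l -> Q l -> Q' l) ->
  pos (f Q' n - f Q n).
Proof.
move=> QQ; rewrite /wsum -!(big_filter (words n)).
apply: (sum_inj_le (phi := id)); rewrite ?filter_uniq ?uniq_words //.
- by move=> l; rewrite !mem_filter mem_words => /and3P [/QQ Ql -> wl]; rewrite Ql.
- by move=> l _; exact: pos_weight.
- by move=> l _; rewrite subrr.
Qed.

Lemma hsum_le w (Q Q' : pred (seq nat)) n : (forall l, is_word l -> Q l -> Q' l) ->
  pos (h w Q' n - h w Q n).
Proof.
move=> QQ; rewrite /hsum -!(big_filter (words n)).
apply: (sum_inj_le (phi := id)); rewrite ?filter_uniq ?uniq_words //.
- by move=> l; rewrite !mem_filter mem_words => /and3P [/QQ Ql -> wl]; rewrite Ql.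
- by move=> l _; exact: pos_head_weight.
- by move=> l _; rewrite subrr.
Qed.

(** A right jump makes 2 the head of the word, and a part [k >= 2] as the head
    contributes [k <= 2 (k - 1)].  A left jump does not change the head. *)
Lemma jump_weight I J K : is_word I -> I != [::] -> jump I J K -> 
  odd (sumn I) ->
  pos (head_weight id K - head_weight id I * (e 2 * weight J)).
Proof.
move=> wI I0 j oI; case: j wI I0 oI =>
  [B p A C Y -> -> op eA eC sz|X A C q D -> -> oq eA eC sz].
  set I' := B ++ _ => wI I0 _.
  have -> : head_weight id (2 :: B ++ A ++ C ++ p :: Y)
       - head_weight id I' * (e 2 * weight (C ++ Y))
     = (2%:R * weight I' - head_weight id I') * (e 2 * weight (C ++ Y)).
    rewrite /I' /= !weight_cat !weight_cons; ring.
  apply: posM; last by apply: posM => //; exact: pos_weight.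
  case: I' wI I0 => // k l /= /andP [k2 _] _; rewrite weight_cons !mulrA -!mulrBl.
  rewrite -natrM -natrB; last by lia.
  by do ?apply: posM => //; [exact: pos_nat | exact: pos_weight].
move=> _ _ oI; have X0 : X != [::].
  move: oI; rewrite sumn_cat; case: (X) => //=.
  by move: (odd_sumn_evens eA); lia.
rewrite !head_weight_cat // !(weight_cons, weight_cat) /=.
set z := (X in pos X); have -> : z = 0 by rewrite /z /=; ring.
exact: pos0.
Qed.

Lemma jump_bound a b : odd a -> odd b ->
  pos (h id (fun l => ~~ hits a l) (a + b).+2 - e 2 * F b * G a).
Proof.
move=> oa ob.
have -> : e 2 * F b * G a = \sum_(u <- [seq (s, t) | s <- words a, t <- words b])
   head_weight id u.1 * (e 2 * weight u.2).
  rewrite big_allpairs_dep mulrC big_distrl; apply: eq_bigr => I _ /=.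
  by rewrite big_distrr /= big_distrr.
have wordsI (u : seq nat * seq nat) : u \in [seq (s, t) | s <- words a, t <- words b] ->
    [/\ is_word u.1, is_word u.2, sumn u.1 = a, sumn u.2 = b &
        jump u.1 u.2 (jumped u.1 u.2)].
  case/allpairsP=> [[I J]] /= []; rewrite !mem_words.
  move=> /andP [/eqP sI wI] /andP [/eqP sJ wJ] ->; split=> //=.
  by apply: jumpedP; rewrite ?sI ?sJ.
rewrite /hsum -big_filter.
apply: (sum_inj_le (phi := fun u => jumped u.1 u.2)).
- by apply: allpairs_uniq; rewrite ?uniq_words // => -[? ?] [? ?].
- by rewrite filter_uniq ?uniq_words.
- move=> [I J] [I' J'] /wordsI [/= wI _ sI _ jI] /wordsI [/= wI' _ sI' _ jI'] E.
  rewrite -E in jI'.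
  by have [-> ->] := jump_inj oa wI wI' sI sI' jI jI'.
- move=> [I J] /wordsI [/= wI wJ sI sJ jI]; rewrite mem_filter mem_words.
  by rewrite (jump_avoids oa wI sI wJ jI) (jump_sum jI) sI sJ eqxx (jump_word wI wJ jI).
- by move=> l _; exact: pos_head_weight.
- move=> [I J] /wordsI [/= wI wJ sI sJ jI]; apply: jump_weight => //.
    by apply: contraTneq oa => I0; rewrite -sI I0.
  by rewrite sI.
Qed.

Lemma pos_sub_ex x y : pos (y - x) -> exists2 d, pos d & y = x + d.
Proof. by exists (y - x); rewrite // addrC subrK. Qed.

Lemma wsum_mul_le x y : pos (F (x + y) - F x * F y).
Proof. by rewrite -wsum_hits; apply: wsum_le. Qed.

Lemma hsum_mul_le w x y : (0 < x)%N -> pos (h w predT (x + y) - h w predT x * F y).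
Proof. by move=> x0; rewrite -hsum_hits //; apply: hsum_le. Qed.

(** No word hits both [x] and [x.+1]. *)
Lemma wsum_mul2_le x y :
  pos (F (x + y).+1 - (F x * F y.+1 + F x.+1 * F y)).
Proof.
rewrite -!wsum_hits addnS addSn (wsum_split predT (hits x)) opprD addrACA.
have -> : f [pred l | hits x l & predT l] (x + y).+1 = f (hits x) (x + y).+1.
  by apply: wsum_ext => l _ /=; rewrite andbT.
rewrite subrr add0r; apply: wsum_le => l wl /= hS; rewrite andbT.
by apply: contraL hS; exact: hits_succ.
Qed.

(** If the head is not 2, then its factor [k.-1] in the weight is at least 2. *)
Lemma split_head2 n : exists r r', [/\ pos r, pos r',
  H n.+2 = e 2 * F n + r & F n.+2 = e 2 * F n + (2%:R * r + r')].
Proof.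
have E w : h w predT n.+2 = (w 2)%:R * e 2 * F n + h w (avoids 2) n.+2.
  rewrite (hsum_split _ predT (hits 2)) -hsum2 -hsum_hits // add2n.
  by congr (_ + _); apply: hsum_ext => l _ /=; rewrite andbT.
exists (h (fun=> 1%N) (avoids 2) n.+2).
exists (h predn (avoids 2) n.+2 - 2%:R * h (fun=> 1%N) (avoids 2) n.+2); split.
- exact: pos_hsum.
- rewrite /hsum big_distrr -sumrB; apply: pos_sum => -[|k l].
    by rewrite /= mulr0 subrr.
  rewrite mem_words => /andP [_ wl]; rewrite hits2 //= => k2.
  have k3 : (2 < k)%N by move: wl k2 => /= /andP [] /=; lia.
  rewrite !mulrA -!mulrBl -natrM -natrB; last by lia.
  by do ?apply: posM => //; [exact: pos_nat | exact: pos_weight].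
- by rewrite E mul1r.
- by rewrite wsum_head // E mul1r; ring.
Qed.

(** If the head is neither 2 nor 3, then its factor [k.-1] in the weight is at
    least 3. *)
Lemma split_head3 n : exists r r', [/\ pos r, pos r',
  H n.+3 = e 2 * F n.+1 + e 3 * F n + r &
  F n.+3 = e 2 * F n.+1 + 2%:R * e 3 * F n + (3%:R * r + r')].
Proof.
pose Q l := ~~ hits 3 l && ~~ hits 2 l.
have E w : h w predT n.+3 = (w 2)%:R * e 2 * F n.+1 + (w 3)%:R * e 3 * F n + h w Q n.+3.
  rewrite (hsum_split _ predT (hits 2)) -hsum2 -hsum_hits // add2n -addrA; congr (_ + _).
    by apply: hsum_ext => l _ /=; rewrite andbT.
  rewrite (hsum_split _ _ (hits 3)) -hsum3 -hsum_hits //; congr (_ + _).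
    apply: hsum_ext => l wl /=; rewrite andbT; case: (boolP (hits 3 l)) => //= h3.
    by apply: contraL h3; exact: hits_succ.
  by apply: hsum_ext => l _ /=; rewrite andbT.
exists (h (fun=> 1%N) Q n.+3).
exists (h predn Q n.+3 - 3%:R * h (fun=> 1%N) Q n.+3); split.
- exact: pos_hsum.
- rewrite /hsum big_distrr -sumrB; apply: pos_sum => -[|k l].
    by rewrite /= mulr0 subrr.
  rewrite mem_words => /andP [_ wl]; rewrite /Q hits2 // hits3 //= => k23.
  have k4 : (3 < k)%N by move: wl k23 => /= /andP [] /=; lia.
  rewrite !mulrA -!mulrBl -natrM -natrB; last by lia.
  by do ?apply: posM => //; [exact: pos_nat | exact: pos_weight].
- by rewrite E !mul1r.
- by rewrite wsum_head // E !mul1r /=; ring.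
Qed.

(* Below, [a] is odd and at least 3, the two paths have [a] and [b = 2 a + 1]
   vertices, and the sums at which words of sum [a + b] are cut divide them
   into blocks of sums [a], [a] and [a + 1]. *)
Section TwoPaths.
Variable c : nat.
Let a := c.+3.
Let b := (a + a).+1.
Hypothesis oa : odd a.

(** Words that hit [a + a] do not hit [b], its successor. *)
Lemma hsum_paths w : h w predT (a + b) =
  h w predT a * F b + h w (avoids a) b * F a + h w (avoids a) (a + a) * F a.+1
  + h w (fun l => [&& ~~ hits (a + a) l, ~~ hits b l & ~~ hits a l]) (a + b).
Proof.
rewrite (hsum_split _ predT (hits a)) -hsum_hits // -!addrA; congr (_ + _).
  by apply: hsum_ext => l _ /=; rewrite andbT.
rewrite (hsum_split _ _ (hits b)) (hsum_split _ [pred l | ~~ _ & _] (hits (a + a))).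
congr (_ + (_ + _)).
- rewrite -hsum_cut //; last by move=> l1 l2 s1; rewrite hits_cat ?s1 // /b; lia.
  by rewrite addnC; apply: hsum_ext => l _ /=; rewrite andbT.
- rewrite -hsum_cut //; last by move=> l1 l2 s1; rewrite hits_cat ?s1 // leq_addr.
  rewrite (_ : a + a + a.+1 = a + b)%N; last by rewrite /b; lia.
  apply: hsum_ext => l wl /=; rewrite andbT; case: (boolP (hits (a + a) l)) => //= hl.
  by rewrite (hits_succ wl hl).
- by apply: hsum_ext => l _ /=; rewrite andbT.
Qed.

Lemma hsum_b w : h w predT b = h w predT a * F a.+1 + h w (avoids a) b.
Proof.
rewrite (hsum_split _ predT (hits a)) -hsum_hits // /b -addnS; congr (_ + _);
by apply: hsum_ext => l _ /=; rewrite andbT.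
Qed.

Lemma hsum_b_avoids w : h w (avoids a) b = h w predT a.+1 * F a +
  h w (fun l => ~~ hits a.+1 l && ~~ hits a l) b.
Proof.
rewrite (hsum_split _ (avoids a) (hits a.+1)) -hsum_hits // addSn; congr (_ + _).
apply: hsum_ext => l wl /=; case: (boolP (hits a.+1 l)) => // hl.
by rewrite hits_pred.
Qed.

(** Among the words that hit none of [a], [a + a] and [b] there are those of the
    form [X ++ 3 :: Y] with [X] of sum [a + a - 1]. *)
Lemma rest_le :
  pos (h id (fun l => [&& ~~ hits (a + a) l, ~~ hits b l & ~~ hits a l]) (a + b)
    - f (avoids a) (c.+2 + a) * F 3 * F c.+2).
Proof.
set Q := (Q in h id Q); rewrite hsum_id // addrAC; apply: posD; last exact: pos_hsum.
rewrite -wsum_cut; last by move=> l1 l2 s1; rewrite hits_cat ?s1 // leq_addl.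
rewrite -wsum_cut; last first.
  by move=> l1 l2 s1 /=; rewrite !hits_cat ?s1 //; rewrite /a; lia.
rewrite (_ : c.+2 + a + 3 + c.+2 = a + b)%N; last by rewrite /b /a; lia.
apply: wsum_le => l wl /= /and3P [h1 h2 h3]; rewrite /Q h3 andbT; apply/andP; split.
  by apply: hits_succ h2.
apply: hits_pred => //; move: h1; congr (hits _ _); rewrite /a /b; lia.
Qed.

(** Expanding [G b] by [hsum_b] and [G (a + b)] by [hsum_paths] leaves, up to
    the inequality of [hsum_le_wsum], only negative terms that come from triples
    of words of sums [a], [a] and [a + 1].
    Splitting by the head of one word of sum [a], the triples with a head 2 are
    paid for by the words that hit [a + a] but not [a], according to
    [jump_bound]; those with a head 3 are paid for by the words of [rest_le];
    and those with a larger head have a nonnegative sum already. *)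
Lemma paths_pos : pos (G (a + b) - G a * G b).
Proof.
have [d1 pd1 E1] := pos_sub_ex rest_le.
have [d2 pd2 E2] : exists2 d, pos d & h id (avoids a) (a + a) = e 2 * F c.+1 * G a + d.
  have oc : odd c.+1 by move: oa; rewrite /a /= !negbK.
  apply: pos_sub_ex; rewrite (_ : (a + a = (a + c.+1).+2)%N); last by rewrite /a; lia.
  exact: jump_bound.
have pd3 : pos (f (avoids a) (c.+2 + a) - F a.+1 * F c.+1).
  rewrite -wsum_hits (_ : (a.+1 + _ = c.+2 + a)%N); last by rewrite /a; lia.
  by apply: wsum_le => l; exact: hits_pred.
have pd4 : pos (f (avoids a) (c.+2 + a) - F c.+2 * F a).
  by rewrite -wsum_hits; apply: wsum_le => l; exact: hits_succ.
have [r [r' [pr pr' Ha Fa]]] := split_head3 c.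
have [s [s' [ps ps' Hc Fc]]] := split_head2 c.+2.
have [t [t' [pt pt' Hd Fd]]] := split_head2 c.
have [d6 pd6 E6] := pos_sub_ex (@hsum_le_wsum (fun l => ~~ hits a.+1 l && ~~ hits a l) b isT).
have Fb := @wsum_head _ e predT b isT; rewrite hsum_b -!wsum_head // in Fb.
have Fb' := @wsum_head _ e (avoids a) b isT.
rewrite hsum_b_avoids -!wsum_head // E6 in Fb'.
have Hb := hsum_b (fun=> 1%N); have Hb' := hsum_b_avoids (fun=> 1%N).
rewrite hsum_paths E1 E2 !hsum_id // Fb Hb Fb' Hb' wsum3.
rewrite -[c.+3]/a in Ha Fa; rewrite -[c.+4]/(a.+1) in Hc Fc.
have pV := pos_wsum (avoids a) (c.+2 + a).
have phb := pos_hsum (fun=> 1%N) (fun l => ~~ hits a.+1 l && ~~ hits a l) b.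
have [pF0 pF1] := (pos_wsum predT c, pos_wsum predT c.+1).
have [pe2 pe3] := (pose 2, pose 3).
have pFm := pos_wsum predT c.+2.
clear - pos0 pos1 posD posM pd3 pd4 pV phb pF0 pF1 pe2 pe3 pFm pr pr' ps ps'
  pt pt' pd1 pd2 pd6 Ha Fa Hc Fc Hd Fd.
move: (f _ (c.+2 + a)) (h _ _ b) (F c) (F c.+1) (F c.+2) (F a) (H a) (F a.+1)
  (H a.+1) (e 2) (e 3) pd3 pd4 pV phb pF0 pF1 pe2 pe3 pFm Ha Fa Hc Fc Hd Fd.
move=> V hb f0 f1 fm fa ha fa' ha' e2 e3 pd3 pd4 pV phb pf0 pf1 pe2 pe3 pfm.
move=> ha_eq fa_eq ha'_eq fa'_eq _ fm_eq.
have pfa : pos fa.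
  by rewrite fa_eq; do ![apply: posD | apply: posM | exact: pos_nat | assumption].
have pfa' : pos fa'.
  by rewrite fa'_eq; do ![apply: posD | apply: posM | exact: pos_nat | assumption].
set P := (X in pos X).
(* In order: the excess of [rest_le], the heads 3 compared with [pd3] and [pd4],
   the excess for the heads 2 and for the heads 3, and the larger heads; the last
   two terms come from words of sum [b] that hit neither [a] nor [a.+1]. *)
have -> : P = d1 + e3 * V * ((t + t) + t' + (t + t) + t') +
   e3 * e2 * f0 * ((V - fa' * f1) + (V - fm * fa)) + d2 * fa' +
   e2 * f1 * fa * (s + s') +
   e3 * f0 * ((e3 * f0 + r) * (e2 * fm + s') + (e2 * f1 + r + r') * s +
              (e2 * f1 + r + r') * (e2 * fm + s')) +
   r * ((e3 * f0 + r + r + r') * fa' + fa * (s + s')) + r' * fa * fa' +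
   fa * d6 + (e3 * f0 + r + r + r') * hb.
  rewrite /P ha_eq fa_eq ha'_eq fa'_eq fm_eq; ring.
by do ![assumption | apply: posD | apply: posM].
Qed.

(** The terms with a factor [e 1] only need that cutting a word at one sum, or
    at two consecutive sums, gives disjoint sets of words. *)
Lemma spider_paths_pos :
  pos (path_e (a + b).-1 + e 1 * path_e (a + b).-2 - path_e a.-1 * path_e b.-1).
Proof.
rewrite /path_e (_ : (a + b).-1.+1 = a + b)%N //.
rewrite (_ : (a + b).-2.+1 = (a + b).-1)%N; last by rewrite /b; lia.
rewrite !prednK //; set x := c.+2 + b.
rewrite -[(a + b).-1]/x -[a.-1]/(c.+2) -[b.-1]/(a + a)%N.
have p1 := paths_pos.
have p2 : pos (F (a + b).-2 - F c.+2 * F (a + a)).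
  rewrite (_ : (a + b).-2 = c.+2 + (a + a))%N; first exact: wsum_mul_le.
  by rewrite /b addnS.
have p3 : pos (F x - (F c.+2 * F b + F a * F (a + a))).
  by have := wsum_mul2_le c.+2 (a + a); rewrite -addnS.
have p4 : pos (F x - F c.+2 * F b) by exact: wsum_mul_le.
have p5 : pos (H x - H a * F (a + a)).
  rewrite (_ : x = a + (a + a))%N; first exact: hsum_mul_le.
  by rewrite /x /b /a; lia.
have p6 := @hsum_le_wsum predT b isT.
have p7 := pos_wsum predT c.+2.
rewrite hsum_id // [in X in e 1 * (X + _)]hsum_id // [G a]hsum_id // [G b]hsum_id // in p1 *.
rewrite -[(a + b).-2]/(x.-1) in p2.
move: p1 p2 p3 p4 p5 p6 p7 (pose 1).
move: (F (a + b)) (H (a + b)) (F a) (H a) (F b) (H b) (F x) (H x) (F x.-1)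
  (F c.+2) (F (a + a)) (e 1) => fn hn fa ha fb hb fx hx fx1 fc faa e1 p1 p2 p3 p4 p5 p6 p7 p8.
set P := (X in pos X).
have -> : P = (fn + hn - (fa + ha) * (fb + hb)) + e1 * ((fx - (fc * fb + fa * faa))
   + (fx - fc * fb) + fc * (fb - hb) + (hx - ha * faa)) + e1 * e1 * (fx1 - fc * faa).
  by rewrite /P; ring.
by do ![assumption | apply: posD | apply: posM].
Qed.
End TwoPaths.

End Cone.

(** * Colorings of paths in finitely many colors *)

Section Truncation.
Local Open Scope ring_scope.
Variables (R : comNzRingType) (M : nat).

(** Congruence modulo ['X^M]: generating functions are truncated to polynomials. *)
Definition eqm (p q : {poly R}) := forall i, (i < M)%N -> p`_i = q`_i.

Lemma eqm_trans p q r : eqm p q -> eqm q r -> eqm p r.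
Proof. by move=> pq qr i iM; rewrite pq ?qr. Qed.

Lemma eqmM p q r : eqm p q -> eqm (r * p) (r * q).
Proof.
move=> pq i iM; rewrite !coefM; apply: eq_bigr => j _; rewrite pq //.
by apply: leq_ltn_trans iM; exact: leq_subr.
Qed.

End Truncation.

Section PathColorings.
Local Open Scope ring_scope.
Variables (R : comNzRingType) (N : nat) (x : 'I_N -> R).

Definition elem k := \sum_(A : {set 'I_N} | #|A| == k) \prod_(i in A) x i.

(** Sum of the monomials of the proper colorings of a path with [l] vertices that
    is attached by one end to a vertex of color [i]. *)
Fixpoint ext_poly l i :=
  if l is l'.+1 then \sum_(j | j != i) x j * ext_poly l' j else 1.

(** The path with [l.+1] vertices, by the color of its first vertex. *)
Definition path_poly l := \sum_i x i * ext_poly l i.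

Lemma ext_polyS l i : ext_poly l.+1 i = path_poly l - x i * ext_poly l i.
Proof. by rewrite /= /path_poly [in RHS](bigD1 i) //= addrAC subrr add0r. Qed.

(** Move the distinguished vertex along the path, one step at a time. *)
Lemma path_poly_join k l :
  \sum_i x i * ext_poly k i * ext_poly l i = path_poly (k + l).
Proof.
elim: l k => [|l IHl] k.
  by rewrite addn0; apply: eq_bigr => i _; rewrite mulr1.
rewrite addnS -addSn -IHl.
transitivity (\sum_i \sum_(j | i != j) x i * ext_poly k i * (x j * ext_poly l j)).
  apply: eq_bigr => i _; rewrite big_distrr /=.
  by apply: eq_bigl => j; rewrite eq_sym.
rewrite (exchange_big_dep predT) //=; apply: eq_bigr => j _.
by rewrite -big_distrl /= mulrA [_ * x j]mulrC.
Qed.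

Definition epoly : {poly R} := \prod_i (1 + x i *: 'X).

Lemma coef_epoly k : epoly`_k = elem k.
Proof.
rewrite /epoly; under eq_bigr => i _ do rewrite addrC.
rewrite bigA_distr /= coef_sum /elem [RHS]big_mkcond /=; apply: eq_bigr => A _.
rewrite -big_mkcond /=.
have -> : \prod_(i in A) (x i *: 'X) = (\prod_(i in A) x i) *: 'X^#|A|.
  rewrite -[in RHS]mul_polyC rmorph_prod /= -prodr_const -big_split /=.
  by apply: eq_bigr => i _; rewrite mul_polyC.
by rewrite coefZ coefXn eq_sym; case: eqP => _; rewrite ?mulr1 ?mulr0.
Qed.

Lemma deriv_prod_lin (s : seq 'I_N) : uniq s ->
  (\prod_(i <- s) (1 + x i *: 'X))^`() =
  \sum_(i <- s) x i *: \prod_(j <- s | j != i) (1 + x j *: 'X).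
Proof.
elim: s => [|k s IHs] /=; first by rewrite !big_nil derivC.
case/andP=> ks us; rewrite !big_cons derivM IHs // eqxx.
rewrite derivD derivC add0r derivZ derivX alg_polyC mul_polyC; congr (_ + _).
  congr (_ *: _); rewrite big_seq [RHS]big_seq_cond; apply: eq_bigl => j.
  by case js: (j \in s) => //=; apply/esym; apply: contraNneq ks => <-.
rewrite big_distrr big_seq [RHS]big_seq; apply: eq_bigr => j js /=.
rewrite big_cons ifT; first by rewrite -scalerAr.
by apply: contraNneq ks => ->.
Qed.

Lemma deriv_epoly :
  epoly^`() = \sum_i x i *: \prod_(j | j != i) (1 + x j *: 'X).
Proof. exact: (deriv_prod_lin (index_enum_uniq _)). Qed.

Section Series.
Variable M : nat.
Local Notation F := (wsum elem predT).

(* [chain n] belongs to the path with [n] vertices, [chain_end n i] to those of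
   its colorings that have color [i] at one end. *)
Definition chain n := if n is n'.+1 then path_poly n' else 1.
Definition chain_end n i := if n is n'.+1 then x i * ext_poly n' i else 0.
Definition chain_poly : {poly R} := \poly_(n < M) chain n.
Definition chain_end_poly i : {poly R} := \poly_(n < M) chain_end n i.
Definition word_poly : {poly R} := \poly_(n < M) F n.

(** Attach a vertex of color [i] to any path, and remove the colorings where its
    neighbor has color [i] as well. *)
Lemma chain_end_rec n i : chain_end n.+1 i + x i * chain_end n i = x i * chain n.
Proof.
case: n => [|n] /=; first by rewrite mulr1 mulr0 addr0.
by rewrite -/(ext_poly n.+1 i) ext_polyS mulrBr subrK.
Qed.

Lemma chain_end_polyE i :
  eqm M ((1 + x i *: 'X) * chain_end_poly i) (x i *: ('X * chain_poly)).
Proof.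
move=> n nM; rewrite mulrDl mul1r coefD -scalerAl !coefZ !coefXM !coef_poly nM.
case: n nM => [|n] nM /=; first by rewrite !mulr0 addr0.
by rewrite (ltnW nM) -chain_end_rec.
Qed.

(** Multiply [chain_end_polyE] by the product of the factors of [epoly] other
    than [1 + x i *: 'X] and sum over [i]. *)
Lemma epoly_chain : eqm M (epoly * (chain_poly - 1)) ('X * epoly^`() * chain_poly).
Proof.
have sumt : eqm M (epoly * (chain_poly - 1)) (\sum_i epoly * chain_end_poly i).
  rewrite -big_distrr; apply: eqmM => n nM.
  rewrite coefB coef_sum coef_poly nM coef1.
  under eq_bigr => i _ do rewrite coef_poly nM.
  case: n nM => [|n] nM /=; first by rewrite subrr big1.
  by rewrite subr0.
apply: eqm_trans sumt _; rewrite deriv_epoly mulr_sumr mulr_suml.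
move=> n nM; rewrite !coef_sum; apply: eq_bigr => i _.
rewrite [epoly](bigD1 i) //=; move: (\prod_(_ | _) _) => E.
rewrite [_ * E]mulrC -[E * _ * _]mulrA (eqmM E (@chain_end_polyE i)) //.
by rewrite -!scalerAr -scalerAl mulrCA mulrA.
Qed.

Lemma elem0 : elem 0 = 1.
Proof.
rewrite /elem (eq_bigl (xpred1 finset.set0)); last by move=> A; rewrite cards_eq0.
by rewrite big_pred1_eq finset.big_set0.
Qed.

Lemma big_ord_from2 (w : nat -> R) n : (0 < n)%N ->
  \sum_(j < n.+1) w j = w 0%N + w 1%N + \sum_(2 <= j < n.+1) w j.
Proof.
by move=> n0; rewrite -(big_mkord predT w) big_ltn // big_ltn // addrA.
Qed.

(** The coefficients of [epoly - 'X * epoly^`()] are [(1 - j) elem j]. *)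
Lemma word_polyE : eqm M ((epoly - 'X * epoly^`()) * word_poly) 1.
Proof.
move=> n nM; rewrite coefM coef1.
under eq_bigr => j _.
  rewrite coef_poly (leq_ltn_trans (leq_subr _ _) nM).
  rewrite (_ : (epoly - 'X * epoly^`())`_j = elem j - elem j *+ j); last first.
    rewrite coefB coefXM coef_deriv coef_epoly.
    by case: {+}j => -[|i] //= _; rewrite coef_epoly.
  over.
case: n nM => [|n] nM.
  by rewrite big_ord1 /= elem0 mulr0n subr0 mul1r wsum0.
rewrite (big_ord_from2 (fun j => (elem j - elem j *+ j) * F (n.+1 - j))) //.
rewrite subn0 elem0 mulr0n subr0 mul1r mulr1n subrr mul0r addr0.
rewrite wsum_head // hsum_rec //.
rewrite -big_split /= big_nat big1 // => j /andP [j2 _].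
rewrite -mulrDl -[elem j *+ j]mulr_natl; set z := wsum _ _ _.
have -> : j%:R = 1 + j.-1%:R :> R by rewrite -mulrS prednK //; lia.
ring.
Qed.

Lemma chain_wsum n : (n < M)%N -> chain n = \sum_(j < n.+1) elem j * F (n - j).
Proof.
move=> nM.
have E : eqm M ((epoly - 'X * epoly^`()) * chain_poly) epoly.
  move=> i iM; have := epoly_chain iM; rewrite mulrBr mulr1 mulrBl !coefB.
  by move=> <-; rewrite opprB addrC subrK.
have -> : chain n = chain_poly`_n by rewrite coef_poly nM.
have := eqmM chain_poly word_polyE nM; rewrite mulr1 => <-.
rewrite mulrCA [chain_poly * word_poly]mulrC mulrCA (eqmM word_poly E) // mulrC coefM.
apply: eq_bigr => j _.
by rewrite coef_epoly coef_poly (leq_ltn_trans (leq_subr _ _) nM).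
Qed.

End Series.

(** The formula of Shareshian and Wachs for paths. *)
Lemma path_polyE l : path_poly l = path_e elem l.
Proof.
have := chain_wsum (leqnn l.+2) => /= ->.
rewrite (big_ord_from2 (fun j => elem j * wsum elem predT (l.+1 - j))) //.
rewrite elem0 subn0 subn1 mul1r /path_e hsum_id // -addrA -addrA; congr (_ + _).
rewrite addrC; congr (_ + _); rewrite hsum_rec //.
by apply: eq_bigr => j _; rewrite mul1r.
Qed.

(** The leg of length 1 has all colors but [i].  Correcting for the color [i], and
    joining the paths with [k.+1] and [l.+1] vertices by an edge between their
    ends, both give the sum of the products of [x i * ext_poly k i] and
    [x i * ext_poly l i]. *)
Lemma sum_three_legs k l :
  \sum_i x i * (ext_poly k i * (ext_poly l i * ext_poly 1 i)) =
  path_poly (k + l).+1 + elem 1 * path_poly (k + l) - path_poly k * path_poly l.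
Proof.
have e1 : elem 1 = path_poly 0.
  by rewrite path_polyE /path_e wsum0 mulr1 /hsum /= big_nil add0r.
have -> : path_poly k * path_poly l = path_poly (k + l).+1 +
    \sum_i (x i * ext_poly k i) * (x i * ext_poly l i).
  rewrite {1}/path_poly mulr_suml -addnS -path_poly_join -big_split /=.
  by apply: eq_bigr => i _; rewrite -mulrDr -/(ext_poly l.+1 i) ext_polyS subrK.
rewrite opprD addrACA subrr add0r e1 -path_poly_join mulr_sumr -sumrB.
apply: eq_bigr => i _; rewrite ext_polyS mulr1; ring.
Qed.

End PathColorings.

(** * Colorings of spiders *)

Section SpiderColorings.
Local Open Scope ring_scope.
Variables (R : comNzRingType) (N : nat) (x : 'I_N -> R).

Definition differ : rel 'I_N := fun i j => i != j.

Lemma ext_path l i :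
  ext_poly x l i = \sum_(t : l.-tuple 'I_N | path differ i t) \prod_(j <- t) x j.
Proof.
elim: l i => [|l IHl] i.
  rewrite (big_pred1 [tuple]) ?big_nil // => t.
  by rewrite (_ : t = [tuple]) ?eqxx //; exact: tuple0.
rewrite /= (reindex (fun u : 'I_N * l.-tuple 'I_N => [tuple of u.1 :: u.2])) /=; last first.
  exists (fun t : l.+1.-tuple 'I_N => (thead t, [tuple of behead t])).
    by move=> [j t] _ /=; congr (_, _); apply/val_inj.
  by move=> t _; rewrite [RHS]tuple_eta; apply/val_inj.
rewrite -(pair_big_dep (fun j => differ i j) (fun j (t : l.-tuple 'I_N) => path differ j t)
   (fun j t => \prod_(k <- j :: t) x k)) /=.
apply: eq_big => [j|j _]; first by rewrite /differ eq_sym.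
by rewrite IHl big_distrr; apply: eq_bigr => t _; rewrite big_cons.
Qed.

Lemma big_option (T : finType) (F : option T -> R) :
  \prod_v F v = F None * \prod_v F (Some v).
Proof.
rewrite (bigD1 None) //=; congr (_ * _).
rewrite (reindex_omap Some id) //=; first by apply: eq_bigl => v; rewrite eqxx.
by case.
Qed.

Definition proper (G : sgraph) (k : {ffun G -> 'I_N}) :=
  [forall u, forall v, adj u v ==> (k u != k v)].

Section Legs.
Variables a b c : nat.

Local Notation S := (spider [:: a; b; c]).

Local Notation legs :=
  ('I_N * (a.-tuple 'I_N * (b.-tuple 'I_N * c.-tuple 'I_N)))%type.

(* A coloring of the spider is a color for the center and a tuple of colors for
   each leg; the tuples start next to the center. *)
Definition color (u : legs) (v : spider_vertex [:: a; b; c]) : 'I_N :=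
  if v is Some p then
    nth u.1 (nth [::] [:: val u.2.1; val u.2.2.1; val u.2.2.2]
              (nat_of_ord (tag p))) (nat_of_ord (tagged p))
  else u.1.

Definition paint (u : legs) : {ffun S -> 'I_N} := [ffun v : S => color u v].

Definition leg0 : 'I_3 := Ordinal (isT : 0 < 3)%N.
Definition leg1 : 'I_3 := Ordinal (isT : 1 < 3)%N.
Definition leg2 : 'I_3 := Ordinal (isT : 2 < 3)%N.

Definition legv (i : 'I_3) (j : 'I_(nth 0%N [:: a; b; c] i)) : S :=
  Some (Tagged (fun i : 'I_(size [:: a; b; c]) => 'I_(nth 0%N [:: a; b; c] i)) j).

Definition unpaint (k : {ffun S -> 'I_N}) : legs :=
  (k None, ([tuple k (legv (i:=leg0) j) | j < a],
   ([tuple k (legv (i:=leg1) j) | j < b], [tuple k (legv (i:=leg2) j) | j < c]))).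

Lemma paintK : cancel paint unpaint.
Proof.
move=> [i [t0 [t1 t2]]]; rewrite /unpaint ffunE /=; congr (_, (_, (_, _)));
by apply: eq_from_tnth => j; rewrite tnth_mktuple ffunE /= -tnth_nth.
Qed.

Lemma unpaintK : cancel unpaint paint.
Proof.
move=> k; apply/ffunP => -[[[[|[|[|i]]] //= iP] j]|]; rewrite ffunE //=;
  move: j; rewrite (bool_irrelevance iP isT) => j; exact: nth_mktuple.
Qed.

Lemma path_differ l i (t : l.-tuple 'I_N) :
  path differ i t <-> forall j : 'I_l, differ (nth i (i :: t) j) (nth i t j).
Proof.
split=> [/(pathP i) tP j|tP]; first by apply: tP; rewrite size_tuple.
by apply/(pathP i) => j; rewrite size_tuple => jl; exact: (tP (Ordinal jl)).
Qed.

Lemma proper_paint (u : legs) : proper (paint u) =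
  [&& path differ u.1 u.2.1, path differ u.1 u.2.2.1 & path differ u.1 u.2.2.2].
Proof.
apply/idP/idP => [/forallP P|].
  have leg (i : 'I_3) l (t : l.-tuple 'I_N) : nth 0%N [:: a; b; c] i = l ->
     nth [::] [:: val u.2.1; val u.2.2.1; val u.2.2.2] i = t -> path differ u.1 t.
    move=> El Et; subst l; apply/path_differ => -[[|j] jl].
      have /forallP /(_ (@legv i (Ordinal jl))) := P None.
      by rewrite !ffunE /= Et.
    have /forallP /(_ (@legv i (Ordinal jl))) := P (@legv i (Ordinal (ltnW jl))).
    by rewrite !ffunE /= eqxx eqxx Et.
  by apply/and3P; split; [exact: (leg leg0)|exact: (leg leg1)|exact: (leg leg2)].
case/and3P => p0 p1 p2.
have leg (i : 'I_3) (j : 'I_(nth 0%N [:: a; b; c] i)) :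
   let t := nth [::] [:: val u.2.1; val u.2.2.1; val u.2.2.2] i in
   differ (nth u.1 (u.1 :: t) j) (nth u.1 t j).
  case: i j => [[|[|[|i]]] //= iP] j.
  - by move/path_differ: p0; apply.
  - by move/path_differ: p1; apply.
  - by move/path_differ: p2; apply.
have sym k k' : differ k k' = differ k' k by rewrite /differ eq_sym.
apply/forallP => v; apply/forallP => w; apply/implyP.
have step (i : 'I_3) (j j' : 'I_(nth 0%N [:: a; b; c] i)) : j.+1 = j' :> nat ->
    differ (paint u (legv j)) (paint u (legv j')).
  by move=> jj'; rewrite !ffunE /=; have := leg i j'; rewrite /= -jj'.
have first (i : 'I_3) (j : 'I_(nth 0%N [:: a; b; c] i)) : j = 0%N :> nat ->
    differ (paint u None) (paint u (legv j)).
  by move=> j0; rewrite !ffunE /=; have := leg i j; rewrite /= j0.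
case: v w => [[i j]|] [[i' j']|] //=; first last.
- by move=> /eqP j0; exact: first.
- by move=> /eqP j0; rewrite -/(differ _ _) sym; exact: first.
case/andP => /eqP E; subst i' => /orP [] /eqP jj'; first exact: step.
by rewrite -/(differ _ _) sym; exact: step.
Qed.

Lemma prod_paint (u : legs) : \prod_v x (paint u v) =
  x u.1 * ((\prod_(j <- u.2.1) x j) * ((\prod_(j <- u.2.2.1) x j) * \prod_(j <- u.2.2.2) x j)).
Proof.
rewrite big_option ffunE; congr (_ * _).
pose Jt (i : 'I_3) := 'I_(nth 0%N [:: a; b; c] i).
transitivity (\prod_(i : 'I_3) \prod_(j : Jt i) x (paint u (@legv i j))).
  rewrite sig_big_dep /=; apply: eq_bigr => -[i j] _ //.
have leg l (t : l.-tuple 'I_N) : \prod_(j < l) x (nth u.1 t j) = \prod_(j <- t) x j.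
  by rewrite [RHS]big_tuple; apply: eq_bigr => j _; rewrite -tnth_nth.
rewrite !big_ord_recl big_ord0 mulr1.
congr (_ * (_ * _)); rewrite -leg; apply: eq_bigr => j _; by rewrite ffunE.
Qed.

(** Once the center is colored, the legs are colored independently. *)
Lemma spider_colorings :
  \sum_(k : {ffun S -> 'I_N} | proper k) \prod_v x (k v) =
  \sum_i x i * (ext_poly x a i * (ext_poly x b i * ext_poly x c i)).
Proof.
rewrite (reindex paint) /=; last first.
  by exists unpaint => k _; [exact: paintK | exact: unpaintK].
rewrite (eq_bigl _ _ proper_paint) (eq_bigr _ (fun u _ => prod_paint u)).
transitivity (\sum_(i : 'I_N) \sum_(v : a.-tuple 'I_N * (b.-tuple 'I_N * c.-tuple 'I_N) |
   [&& path differ i v.1, path differ i v.2.1 & path differ i v.2.2])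
   x i * ((\prod_(j <- v.1) x j) * ((\prod_(j <- v.2.1) x j) * \prod_(j <- v.2.2) x j))).
  by rewrite pair_big_dep.
apply: eq_bigr => i _; rewrite -big_distrr /=; congr (_ * _); rewrite !ext_path.
rewrite [RHS]big_distrl /=; rewrite -(pair_big_dep (fun t : a.-tuple 'I_N => path differ i t)
  (fun _ (v : b.-tuple 'I_N * c.-tuple 'I_N) => path differ i v.1 && path differ i v.2)
  (fun t v => (\prod_(j <- t) x j) * ((\prod_(j <- v.1) x j) * \prod_(j <- v.2) x j))) /=.
apply: eq_bigr => t _; rewrite -big_distrr /=; congr (_ * _).
rewrite [RHS]big_distrl /=; rewrite -(pair_big_dep (fun t : b.-tuple 'I_N => path differ i t)
  (fun _ (v : c.-tuple 'I_N) => path differ i v)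
  (fun t v => (\prod_(j <- t) x j) * \prod_(j <- v) x j)) /=.
by apply: eq_bigr => s _; rewrite -big_distrr.
Qed.

End Legs.

Lemma spider_colorings1 k l :
  \sum_(u : {ffun spider [:: k; l; 1] -> 'I_N} | proper u) \prod_v x (u v) =
  path_poly x (k + l).+1 + elem x 1 * path_poly x (k + l)
    - path_poly x k * path_poly x l.
Proof. by rewrite spider_colorings sum_three_legs. Qed.

End SpiderColorings.

(** * Coefficients in finitely many variables *)

Lemma fsbig_reindex_fin (V : nmodType) (T : choiceType) (J : finType)
    (D : set T) (P : pred J) (phi : J -> T) (F : T -> V) : injective phi ->
  (forall j, P j -> D (phi j)) ->
  (forall i, D i -> F i != 0%R -> exists2 j, P j & i = phi j) ->
  (\sum_(i \in D) F i)%R = (\sum_(j | P j) F (phi j))%R.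
Proof.
move=> inj PD DP.
pose r := [seq phi j | j <- enum J & P j].
rewrite (@fsbigE _ _ _ _ _ r).
- rewrite big_map big_filter_cond /= big_enum_cond /=; apply: eq_bigl => j.
  by case Pj: (P j) => //=; apply/mem_set/PD.
- by rewrite /r map_inj_uniq // filter_uniq // enum_uniq.
- move=> i /= /mapP [j]; rewrite mem_filter => /andP [Pj _] ->; exact: PD.
- move=> i Di ir; apply/eqP; apply: contraNT ir => /(DP i Di) [j Pj ->].
  by apply: map_f; rewrite mem_filter Pj mem_enum.
Qed.

(** A coefficient of a product or of a chromatic symmetric function involves only
    the variables of its monomial, so it can be computed in a polynomial ring in
    sufficiently many variables. *)
Section FiniteVariables.
Local Open Scope ring_scope.
Variable N : nat.

Definition below (m : monomial) := forall i, i \in m -> (i < N)%N.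

Definition expo (m : monomial) : 'X_{1..N} := [multinom m (val i) | i < N].

Definition mono (k : 'X_{1..N}) : monomial :=
  seq_mset (flatten [seq nseq (k i) (val i) | i <- enum 'I_N]).

Lemma monoE k (i : 'I_N) : mono k i = k i.
Proof.
rewrite mset_seqE count_flatten -map_comp sumnE big_map big_enum /= (bigD1 i) //=.
rewrite count_nseq /= eqxx mul1n big1 ?addn0 // => j ji.
by rewrite count_nseq /= -val_eqE /= eq_sym in ji *; rewrite (negbTE ji).
Qed.

Lemma mono_below k : below (mono k).
Proof.
move=> i; rewrite in_mset mset_seqE -has_count => /hasP [j].
by case/flattenP => s /mapP [l _ ->] /nseqP [-> _] /eqP <-; exact: ltn_ord.
Qed.

Lemma monoK : cancel mono expo.
Proof. by move=> k; apply/mnmP => i; rewrite mnmE monoE. Qed.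

Lemma expo_inj m m' : below m -> below m' -> expo m = expo m' -> m = m'.
Proof.
move=> bm bm' /mnmP E; apply/msetP => i.
case: (ltnP i N) => iN; first by have := E (Ordinal iN); rewrite !mnmE.
have out (p : monomial) : below p -> p i = 0%N.
  by move=> bp; apply/eqP; rewrite mset_eq0; apply: contraL iN => /bp; rewrite -ltnNge.
by rewrite !out.
Qed.

Lemma expoK m : below m -> mono (expo m) = m.
Proof. by move=> bm; apply: expo_inj => //; [exact: mono_below | exact: monoK]. Qed.

Lemma expoD m m' : expo (m `+` m')%mset = (expo m + expo m')%MM.
Proof. by apply/mnmP => i; rewrite mnmDE !mnmE msetE2. Qed.

Lemma prodX (s : seq 'I_N) :
  \prod_(i <- s) 'X_i = 'X_[expo (seq_mset (map val s))] :> {mpoly int[N]}.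
Proof.
elim: s => [|i s IHs].
  rewrite big_nil (_ : expo _ = 0%MM) ?mpolyX0 //.
  by apply/mnmP => i; rewrite mnm0E mnmE mset_seqE.
rewrite big_cons IHs -mpolyXD; congr 'X_[_]; apply/mnmP => j.
by rewrite mnmDE mnm1E !mnmE !mset_seqE /= val_eqE.
Qed.

Lemma coef_prodX (s : seq 'I_N) m : below m ->
  (\prod_(i <- s) 'X_i : {mpoly int[N]})@_(expo m) = ps_mon (seq_mset (map val s)) m.
Proof.
move=> bm; rewrite prodX mcoeffX /ps_mon; congr (_ %:R); congr nat_of_bool.
apply/eqP/eqP => [E|->] //; apply/esym/expo_inj => // i.
rewrite in_mset mset_seqE -has_count => /hasP [j /mapP [l _ ->] /eqP <-]; exact: ltn_ord.
Qed.

Local Notation X := (fun i => 'X_i : {mpoly int[N]}).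

Lemma coef_elem r m : below m -> (elem X r)@_(expo m) = elem_sym r m.
Proof.
move=> bm; rewrite /elem_sym /ps_sum raddf_sum /=.
rewrite (@fsbig_reindex_fin _ _ {set 'I_N} _ (fun A => #|A| == r)
  (fun A => [fset val i | i in A]%fset)).
- apply: eq_bigr => A _.
  have -> : \prod_(i in A) 'X_i = \prod_(i <- enum A) 'X_i :> {mpoly int[N]}.
    by rewrite big_enum.
  rewrite (coef_prodX (enum A) bm); congr (ps_mon _ _).
  apply/eq_seq_msetP; apply: uniq_perm.
  + by rewrite map_inj_uniq ?enum_uniq //; exact: val_inj.
  + exact: fset_uniq.
  + move=> i; apply/mapP/imfsetP => [[j jA ->]|[j jA ->]];
    by exists j; rewrite ?mem_enum // in jA *.
- move=> A B /fsetP E; apply/setP => i; apply/idP/idP => iA.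
    have := E (val i); rewrite in_imfset // => /esym /imfsetP [j /= jB].
    by move/val_inj => ->.
  have := E (val i); rewrite [RHS]in_imfset // => /imfsetP [j /= jB].
  by move/val_inj => ->.
- by move=> A /eqP <- /=; rewrite card_imfset //; [rewrite -cardE | exact: val_inj].
- move=> A /= cA; rewrite /ps_mon; case: (m =P seq_mset A) => [E _|_ /eqP //].
  have bA i : i \in A -> (i < N)%N.
    by move=> iA; apply: bm; rewrite E in_mset mset_seqE -has_count has_pred1.
  have EA : A = [fset val i | i in [set i : 'I_N | val i \in A]]%fset.
    apply/fsetP => i; apply/idP/imfsetP => [iA|[j /=]]; last by rewrite inE => jA ->.
    by exists (Ordinal (bA i iA)); rewrite ?inE.
  exists [set i : 'I_N | val i \in A] => //.
  rewrite -cA; apply/eqP; rewrite [in RHS]EA card_imfset //=; first by rewrite -cardE.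
  exact: val_inj.
Qed.

Lemma coef_mul (f g : pseries) (p q : {mpoly int[N]}) :
  (forall m, below m -> p@_(expo m) = f m) ->
  (forall m, below m -> q@_(expo m) = g m) ->
  forall m, below m -> (p * q)@_(expo m) = ps_mul f g m.
Proof.
move=> pf qg m bm; rewrite mcoeffM /ps_mul.
rewrite (@fsbig_reindex_fin _ _ _ _
  (fun k : 'X_{1..N < (mdeg (expo m)).+1, (mdeg (expo m)).+1} =>
    expo m == (k.1 + k.2)%MM) (fun k => (mono k.1, mono k.2))) /=.
- apply: eq_bigr => k _; rewrite -pf; last exact: mono_below.
  by rewrite -qg ?monoK //; exact: mono_below.
- move=> [k1 k2] [l1 l2] [] E1 E2.
  by congr (_, _); apply/val_inj; rewrite /= -[LHS]monoK -[RHS]monoK ?E1 ?E2.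
- move=> k /eqP E /=; apply: expo_inj => //; last by rewrite expoD !monoK.
  by move=> i; rewrite in_msetD => /orP [] /mono_below.
- move=> [m1 m2] /= E _; subst m.
  have b1 : below m1 by move=> i im; apply: bm; rewrite in_msetD im.
  have b2 : below m2 by move=> i im; apply: bm; rewrite in_msetD im orbT.
  have d1 : (mdeg (expo m1) < (mdeg (expo (m1 `+` m2)%mset)).+1)%N.
    by rewrite expoD mdegD ltnS leq_addr.
  have d2 : (mdeg (expo m2) < (mdeg (expo (m1 `+` m2)%mset)).+1)%N.
    by rewrite expoD mdegD ltnS leq_addl.
  by exists (BMultinom d1, BMultinom d2); rewrite /= ?expoD // !expoK.
Qed.

Lemma coef_elem_part l m : below m ->
  (\prod_(r <- l) elem X r)@_(expo m) = elem_sym_part l m.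
Proof.
elim: l m => [|r l IHl] m bm; rewrite /elem_sym_part /=.
  rewrite big_nil; have := coef_prodX [::] bm; rewrite big_nil => ->.
  by congr (ps_mon _ _); apply/msetP => i; rewrite mset_seqE mset0E.
rewrite big_cons; apply: (@coef_mul (elem_sym r) _ _ _ _ _ m bm) => // m' bm'.
exact: coef_elem.
Qed.

Lemma coef_chromatic (G : sgraph) m : below m ->
  (\sum_(k : {ffun G -> 'I_N} | proper k) \prod_v 'X_(k v) : {mpoly int[N]})@_(expo m)
   = chromatic_sym G m.
Proof.
move=> bm; rewrite /chromatic_sym /ps_sum raddf_sum /=.
rewrite (@fsbig_reindex_fin _ _ {ffun G -> 'I_N} _ (@proper N G)
  (fun k => [ffun v => val (k v)])).
- apply: eq_bigr => k _.
  have -> : \prod_v 'X_(k v) = \prod_(i <- [seq k v | v : G]) 'X_i :> {mpoly int[N]}.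
    by rewrite big_image.
  rewrite (coef_prodX _ bm) -map_comp; congr (ps_mon (seq_mset _) _).
  by apply: eq_map => v; rewrite ffunE.
- by move=> k k' /ffunP E; apply/ffunP => v; apply/val_inj; have := E v; rewrite !ffunE.
- move=> k /forallP pk u v uv; rewrite !ffunE val_eqE.
  by have /forallP /(_ v) := pk u; rewrite uv.
- move=> k pk; rewrite /ps_mon; case: (m =P seq_mset _) => [E _|_ /eqP //].
  have kN v : (k v < N)%N.
    apply: bm; rewrite E in_mset mset_seqE -has_count has_pred1.
    exact: map_f (mem_enum _ v).
  exists [ffun v => Ordinal (kN v)].
    by apply/forallP => u; apply/forallP => v; apply/implyP => /pk; rewrite !ffunE.
  by apply/ffunP => v; rewrite !ffunE.
Qed.

End FiniteVariables.

(** * e-positivity *)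

Section Specialize.
Local Open Scope ring_scope.
Variables (R R' : comNzRingType) (phi : {rmorphism R -> R'}).
Variables (e : nat -> R) (e' : nat -> R') (n : nat).
Hypothesis phie : forall k, (0 < k <= n)%N -> phi (e k) = e' k.

Lemma weight_morph l : is_word l -> (sumn l <= n)%N -> phi (weight e l) = weight e' l.
Proof.
elim: l => [|k l IHl]; first by rewrite /weight !big_nil rmorph1.
rewrite /is_word /= => /andP [k2 wl] ln.
rewrite !weight_cons !rmorphM rmorph_nat phie ?IHl //; lia.
Qed.

Lemma head_weight_morph w l : is_word l -> (sumn l <= n)%N ->
  phi (head_weight e w l) = head_weight e' w l.
Proof.
case: l => [|k l]; first by rewrite rmorph0.
rewrite /is_word /= => /andP [k2 wl] ln.
rewrite !rmorphM rmorph_nat phie ?weight_morph //; lia.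
Qed.

Lemma path_e_morph k : (k < n)%N -> phi (path_e e k) = path_e e' k.
Proof.
move=> kn; rewrite /path_e rmorphD rmorphM phie; last by case: (n) kn.
rewrite /hsum /wsum !raddf_sum big_seq_cond [in RHS]big_seq_cond /=.
congr (_ + _ * _).
  by apply: eq_bigr => l /andP [+ _]; rewrite mem_words => /andP [/eqP E wl];
     rewrite head_weight_morph // E.
rewrite big_seq_cond [in RHS]big_seq_cond /=.
apply: eq_bigr => l /andP [+ _]; rewrite mem_words => /andP [/eqP E wl].
by rewrite weight_morph // E ltnW.
Qed.

End Specialize.

Section Positivity.
Local Open Scope ring_scope.
Variable n : nat.

(** Symmetric functions are represented by polynomials in independent variables
    that stand for [e_1], ..., [e_n], for every number of variables [x_i] at once. *)
Definition epos (p : {mpoly int[n]}) := forall k, 0 <= p@_k.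

Definition evar k : {mpoly int[n]} :=
  if insub k.-1 is Some i then if k == 0%N then 0 else 'X_(i : 'I_n) else 0.

Lemma epos0 : epos 0. Proof. by move=> k; rewrite mcoeff0. Qed.
Lemma epos1 : epos 1. Proof. by move=> k; rewrite mcoeff1 ler0n. Qed.
Lemma eposD p q : epos p -> epos q -> epos (p + q).
Proof. by move=> pp pq k; rewrite mcoeffD addr_ge0. Qed.
Lemma eposM p q : epos p -> epos q -> epos (p * q).
Proof. by move=> pp pq k; rewrite mcoeffM sumr_ge0 // => i _; rewrite mulr_ge0. Qed.
Lemma epos_evar k : epos (evar k).
Proof.
rewrite /evar; case: insub => [i|]; last exact: epos0.
by case: eqP => _; [exact: epos0 | move=> m; rewrite mcoeffX ler0n].
Qed.

Lemma evarS (i : 'I_n) : evar i.+1 = 'X_i.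
Proof. by rewrite /evar /= valK. Qed.

Definition parts (k : 'X_{1..n}) : seq nat :=
  sort geq (flatten [seq nseq (k i) (val i).+1 | i <- enum 'I_n]).

Definition mult (l : seq nat) : 'X_{1..n} := [multinom count_mem (val i).+1 l | i < n].

Lemma perm_parts k :
  perm_eq (parts k) (flatten [seq nseq (k i) (val i).+1 | i <- enum 'I_n]).
Proof. by rewrite perm_sort. Qed.

Lemma partsK : cancel parts mult.
Proof.
move=> k; apply/mnmP => i; rewrite mnmE (permP (perm_parts k)).
rewrite count_flatten -map_comp sumnE big_map big_enum /= (bigD1 i) //=.
rewrite count_nseq /= eqxx mul1n big1 ?addn0 // => j ji.
by rewrite count_nseq /= eqSS val_eqE (negbTE ji).
Qed.

Lemma parts_partition k : is_partition (parts k).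
Proof.
rewrite /is_partition sort_sorted /=; last by move=> a b; exact: leq_total.
rewrite (perm_mem (perm_parts k)); apply/negP => /flattenP [s /mapP [i _ ->]].
by move/nseqP => [].
Qed.

Lemma prod_parts (R : comNzRingType) (e : nat -> R) k :
  \prod_(r <- parts k) e r = \prod_(i < n) e i.+1 ^+ k i.
Proof.
rewrite (perm_big _ (perm_parts k)) big_flatten /= big_map big_enum /=.
by apply: eq_bigr => i _; rewrite big_nseq iter_mulr_1.
Qed.

(** The parts of a monomial in the [e_k] form a partition, and its coefficient is
    that of the partition in the e-expansion. *)
Lemma e_positive_of_epos (g : pseries) (p : {mpoly int[n]}) : epos p ->
  (forall N m, below N m ->
     g m = (p \mPo [tuple elem (fun i => 'X_i : {mpoly int[N]}) i.+1
                    | i < n])@_(expo N m)) ->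
  e_positive g.
Proof.
move=> pp gp.
pose c : {fsfun seq nat -> int with 0} :=
  [fsfun l in [fset parts k | k in msupp p]%fset => p@_(mult l)].
have cE k : k \in msupp p -> c (parts k) = p@_k.
  by move=> kp; rewrite fsfunE ifT ?partsK //; apply/imfsetP; exists k.
have csupp : finsupp c = [fset parts k | k in msupp p]%fset.
  apply/fsetP => l; rewrite mem_finsupp; apply/idP/idP.
    by rewrite fsfunE; case: ifP => //; rewrite eqxx.
  by case/imfsetP => k /= kp ->; rewrite cE // -mcoeff_msupp.
exists c; split; [split|].
- by move=> l; rewrite csupp => /imfsetP [k _ ->]; exact: parts_partition.
- move=> m; pose N := (\max_(i <- finsupp m) i).+1.
  have bm : below N m.
    move=> i im; rewrite /N ltnS; apply: (@leq_bigmax_seq _ _ xpredT id) => //.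
    by rewrite multiset.msuppE.
  rewrite (gp N m bm) comp_mpolyEX raddf_sum /= csupp.
  rewrite (perm_big [seq parts k | k <- msupp p]); last first.
    apply: uniq_perm; first exact: fset_uniq.
      by rewrite map_inj_uniq ?msupp_uniq //; exact: can_inj partsK.
    by move=> l; apply/imfsetP/mapP => -[k kp ->]; exists k.
  rewrite [RHS]big_map [LHS]big_seq [RHS]big_seq; apply: eq_bigr => k kp.
  rewrite cE // mcoeffZ -(coef_elem_part _ bm) prod_parts comp_mpolyX.
  by congr (_ * _@__); apply: eq_bigr => i _; rewrite tnth_mktuple.
- move=> l; rewrite fsfunE; case: ifP => // _; exact: pp.
Qed.

End Positivity.

Theorem theorem3p8 (m : nat) (hm : 1 <= m) :
  graph_e_positive (spider [:: 4 * m + 2; 2 * m; 1]).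
Proof.
case: m hm => // m _.
pose c := 2 * m; pose a := c.+3; pose b := (a + a).+1; pose n := a + b.
pose e := evar n.
pose p := (path_e e (a + b).-1 + e 1 * path_e e (a + b).-2
             - path_e e a.-1 * path_e e b.-1)%R.
have pp : epos p.
  apply: spider_paths_pos; [exact: epos0|exact: epos1|exact: eposD|exact: eposM|
    exact: epos_evar|].
  by rewrite /c /= mul2n odd_double.
have [k [l [kE lE ->]]] : exists k l,
    [/\ k = b.-1, l = a.-1 & [:: 4 * m.+1 + 2; 2 * m.+1; 1] = [:: k; l; 1]].
  exists b.-1, a.-1; split=> //; rewrite /b /a /c; congr [:: _; _; _]; lia.
apply: (e_positive_of_epos pp) => N u bu.
rewrite -(coef_chromatic _ bu); congr (mcoeff _ _).
pose X (i : 'I_N) := ('X_i : {mpoly int[N]})%R; set lq := [tuple _ | i < n].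
have lqE j : 0 < j <= n -> (evar n j \mPo lq = elem X j)%R.
  case: j => // j jn; rewrite (evarS (Ordinal jn)) comp_mpolyXU.
  by rewrite (nth_mktuple _ _ (Ordinal jn)).
have compE p1 p2 p3 p4 p5 : ((p1 + p2 * p3 - p4 * p5) \mPo lq = p1 \mPo lq
    + (p2 \mPo lq) * (p3 \mPo lq) - (p4 \mPo lq) * (p5 \mPo lq))%R.
  by rewrite comp_mpolyB comp_mpolyD !rmorphM.
have pathE j : j < n -> (path_e e j \mPo lq = path_poly X j)%R.
  by move=> jn; rewrite path_polyE (path_e_morph lqE).
transitivity (path_poly X (k + l).+1 + elem X 1 * path_poly X (k + l)
  - path_poly X k * path_poly X l)%R; first exact: (spider_colorings1 X k l).
rewrite /p compE lqE // [(path_poly X k * _)%R]mulrC.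
congr (_ + _ * _ - _ * _)%R; rewrite pathE ?kE ?lE //; try congr (path_poly X _);
  by rewrite /n /b /a; lia.
Qed.
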